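(* The problem \textsc{Foremost-path TGR} can be solved in $\mathcal{O}(n^3\log n)$ time and $\mathcal{O}(n^2)$ space. Furthermore, if the instance is realizable, a realization with at most $n^2$ time labels in total can be computed within the same time and space bounds.
   Context: A temporal graph $\mathcal{G}=(G,\lambda)$ consists of a static undirected graph $G=(V,E)$ with $V=[n]=\{1,\dots,n\}$ and a labeling $\lambda:E\to 2^{\mathbb{N}_{>0}}$ assigning to each edge the (finite) set of positive times at which it appears; a pair $(\{u,v\},\tau)$ with $\tau\in\lambda(\{u,v\})$ is a temporal edge, and the number of time labels is $\sum_{e\in E}|\lambda(e)|$. A strict temporal $uv$-path is a path $u=v_0,v_1,\dots,v_k=v$ in $G$ with pairwise distinct vertices together with times $\tau_1<\tau_2<\dots<\tau_k$ such that $\tau_i\in\lambda(\{v_{i-1},v_i\})$; its arrival time is $\tau_k$. The foremost matrix $\mathrm{Fo}(\mathcal{G})$ is the $n\times n$ matrix with $\mathrm{Fo}(\mathcal{G})_{uu}=0$, and for $u\neq v$, $\mathrm{Fo}(\mathcal{G})_{uv}$ is the minimum arrival time of a strict temporal $uv$-path, or $\infty$ if none exists. A distance matrix is an $n\times n$ matrix $D$ with entries in $\mathbb{N}\cup\{\infty\}$ such that $D_{uv}=0$ iff $u=v$. \textsc{Foremost-path TGR}: given $n$ and an $n\times n$ distance matrix $D$, decide whether there exists a temporal graph $\mathcal{G}$ on vertex set $[n]$ with $\mathrm{Fo}(\mathcal{G})=D$ (such a $\mathcal{G}$ is called a realization of $D$). *)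

(* Defs.v *)
From HB Require Import structures.
From mathcomp Require Export all_boot all_order all_algebra.
From mathcomp Require Export finmap.
From mathcomp Require Export boolp.

Set Implicit Arguments.
Unset Strict Implicit.
Unset Printing Implicit Defensive.

(** * Temporal graphs *)

(* The vertex set [n] is 'I_n (vertices are numbered from 0).  An edge {u, v} is
   a two-element set; only the values of [labels] on [edges] are meaningful. *)
Record tgraph (n : nat) := TGraph {
  edges : {set {set 'I_n}};
  labels : {set 'I_n} -> {fset nat};
  edges_card : forall e, e \in edges -> #|e| = 2;
  labels_gt0 : forall e t, e \in edges -> t \in labels e -> 0 < t
}.

Definition tedge n (G : tgraph n) (u v : 'I_n) (t : nat) : bool :=
  ([set u; v]%SET \in edges G) && (t \in labels G [set u; v]%SET).

Definition nlabels n (G : tgraph n) : nat :=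
  \sum_(e in edges G) #|` labels G e|.

(* The path u = v_0, v_1, ..., v_k = v with times t_1 < ... < t_k is given by u
   and the sequence p = [:: (v_1, t_1); ...; (v_k, t_k)]. The time component of
   the starting point (u, 0) is not used. *)
Definition strict_tpath n (G : tgraph n) (u v : 'I_n) (p : seq ('I_n * nat)) :
    bool :=
  [&& path (fun x y => tedge G x.1 y.1 y.2) (u, 0) p,
      uniq (u :: unzip1 p), last u (unzip1 p) == v & sorted ltn (unzip2 p)].

Definition arrival n (p : seq ('I_n * nat)) : nat := last 0 (unzip2 p).

(** * Foremost matrices; [None] stands for infinity *)

Definition min_option (P : pred nat) : option nat :=
  match pselect (exists t, P t) with
  | left exP => Some (ex_minn exP)
  | right _ => None
  end.

Definition Fo n (G : tgraph n) : 'M[option nat]_n :=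
  \matrix_(u, v)
    if u == v then Some 0
    else min_option (fun t =>
      `[< exists p, strict_tpath G u v p /\ arrival p = t >]).

Definition distance_matrix n (D : 'M[option nat]_n) : Prop :=
  forall u v, D u v = Some 0 <-> u = v.

Definition realization n (D : 'M[option nat]_n) (G : tgraph n) : Prop :=
  Fo G = D.

Definition realizable n (D : 'M[option nat]_n) : Prop :=
  exists G : tgraph n, realization D G.

(** * Word RAM

   Programs of a word RAM with w-bit words, written with structured control
   flow.  A program uses finitely many registers and a random-access memory of
   s words.  Every instruction and every evaluation of a branch or loop
   condition takes one unit of time; accessing an address >= s is a fault (the
   program has no execution), so s bounds the space used. *)

Inductive binop := OAdd | OSub | OMul | ODiv | OMod | OLt | OEq.

Inductive cmd :=
| Skip
| Const (x k : nat)
| Bin (o : binop) (x y z : nat)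
| Read (x y : nat)                  (* x := M[y] *)
| Write (x y : nat)                 (* M[x] := y *)
| Seq (c1 c2 : cmd)
| If (x : nat) (c1 c2 : cmd)        (* test: x <> 0 *)
| While (x : nat) (c : cmd).

Record state := State { regs : nat -> nat; mem : nat -> nat }.

Definition upd (f : nat -> nat) (x a : nat) : nat -> nat :=
  fun y => if y == x then a else f y.

Definition set_reg (st : state) (x a : nat) : state :=
  State (upd (regs st) x a) (mem st).

Definition set_mem (st : state) (x a : nat) : state :=
  State (regs st) (upd (mem st) x a).

Definition eval_binop (o : binop) (a b : nat) : nat :=
  match o with
  | OAdd => a + b
  | OSub => a - b
  | OMul => a * b
  | ODiv => a %/ b
  | OMod => a %% b
  | OLt => a < b
  | OEq => a == b
  end.

(* [exec w s c st t st']: with w-bit words and s words of memory, c started in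
   st halts in st' after t units of time. *)
Inductive exec (w s : nat) : cmd -> state -> nat -> state -> Prop :=
| ESkip st : exec w s Skip st 1 st
| EConst x k st : exec w s (Const x k) st 1 (set_reg st x (k %% 2 ^ w))
| EBin o x y z st :
    exec w s (Bin o x y z) st 1
      (set_reg st x (eval_binop o (regs st y) (regs st z) %% 2 ^ w))
| ERead x y st :
    regs st y < s ->
    exec w s (Read x y) st 1 (set_reg st x (mem st (regs st y)))
| EWrite x y st :
    regs st x < s ->
    exec w s (Write x y) st 1 (set_mem st (regs st x) (regs st y))
| ESeq c1 c2 st1 st2 st3 t1 t2 :
    exec w s c1 st1 t1 st2 -> exec w s c2 st2 t2 st3 ->
    exec w s (Seq c1 c2) st1 (t1 + t2) st3
| EIfTrue x c1 c2 st t st' :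
    regs st x != 0 -> exec w s c1 st t st' ->
    exec w s (If x c1 c2) st t.+1 st'
| EIfFalse x c1 c2 st t st' :
    regs st x = 0 -> exec w s c2 st t st' ->
    exec w s (If x c1 c2) st t.+1 st'
| EWhileTrue x c st1 st2 st3 t1 t2 :
    regs st1 x != 0 -> exec w s c st1 t1 st2 ->
    exec w s (While x c) st2 t2 st3 ->
    exec w s (While x c) st1 (t1 + t2).+1 st3
| EWhileFalse x c st :
    regs st x = 0 -> exec w s (While x c) st 1 st.

(** * Input and output conventions *)

Definition enc_entry (d : option nat) : nat := if d is Some k then k.+1 else 0.

(* Register 0 holds n, cells 0, ..., n ^ 2 - 1 hold D in row-major order, and
   everything else is 0. *)
Definition input n (D : 'M[option nat]_n) : state :=
  State (upd (fun=> 0) 0 n)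
        (nth 0 [seq enc_entry (D u v) | u <- enum 'I_n, v <- enum 'I_n]).

(* The usual word-size assumption: a word can hold every input number, and can
   address c * (n + 1) ^ 2 cells. *)
Definition word_size_ok (c w n : nat) (D : 'M[option nat]_n) : Prop :=
  c * n.+1 ^ 2 <= 2 ^ w /\ forall u v, enc_entry (D u v) < 2 ^ w.

(* A list of m triples (u, v, t) is output in memory: register 0 holds m and
   register 1 the address of the first of the 3 * m cells. *)
Definition output_triples (st : state) : seq (nat * nat * nat) :=
  mkseq (fun i => let a := regs st 1 + 3 * i in
                  (mem st a, mem st a.+1, mem st a.+2)) (regs st 0).

Definition output_within (s : nat) (st : state) : Prop :=
  regs st 1 + 3 * regs st 0 <= s.

(* The temporal edges of G, each listed exactly once, as (u, v, t) with u < v. *)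
Definition lists_tgraph n (ts : seq (nat * nat * nat)) (G : tgraph n) : Prop :=
  uniq ts /\
  forall a b t, (a, b, t) \in ts <->
    exists u v : 'I_n, [/\ a = u, b = v, u < v & tedge G u v t].

(** * Time and space bounds *)

Definition big_O (f g : nat -> nat) : Prop :=
  exists c n0, forall n, n0 <= n -> f n <= c * g n.

(* The floor of log_2 n, within a constant factor of log n for n >= 2. *)
Definition log (n : nat) : nat := trunc_log 2 n.

(* p decides realizability of n x n distance matrices in time T n and space S n,
   leaving 1 (yes) or 0 (no) in register 0. *)
Definition decides_foremost_TGR (p : cmd) (T S : nat -> nat) : Prop :=
  exists c, forall n (D : 'M[option nat]_n) w,
    distance_matrix D -> word_size_ok c w D ->
    exists t st,
      [/\ exec w (S n) p (input D) t st, t <= T n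
        & regs st 0 = `[< realizable D >] :> nat].

Definition constructs_foremost_TGR (p : cmd) (T S : nat -> nat) : Prop :=
  exists c, forall n (D : 'M[option nat]_n) w,
    distance_matrix D -> word_size_ok c w D -> realizable D ->
    exists t st (G : tgraph n),
      [/\ exec w (S n) p (input D) t st, t <= T n,
          output_within (S n) st /\ lists_tgraph (output_triples st) G
        & realization D G /\ nlabels G <= n ^ 2].

(* Main.v *)
Require Import Defs.
From mathcomp Require Import zify.

Set Implicit Arguments.
Unset Strict Implicit.
Unset Printing Implicit Defensive.

(** A label t on the edge {w, v} creates no path that is faster than D allows iff
    no x has D x w < t < D x v or D x v < t < D x w.  Hence D is realizable iff
    for all u <> v with t = D u v finite there is a vertex w with D u w < t such
    that {w, v} may carry the label t in this sense, and choosing one such w for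
    each pair (u, v) gives a realization with at most n ^ 2 labels.

    Once every column of D is sorted, all times t = D u v that are forbidden on
    {w, v} are found by merging columns w and v in O(n) steps, while keeping the
    maximum of the other column over the rows passed so far.  The sorting itself
    is affordable with O(n ^ 2) steps per column, by computing the rank of each
    entry, so O(n ^ 3) steps suffice.  A temporal edge chosen for several pairs
    (u, v) is output only for the first of them, which again takes O(n) steps per
    pair to detect. *)

(** * Structured programs on the word RAM *)

(** Whether a label is admissible depends on [D] alone and not on the other labels. This is why the
    predecessors can be chosen independently: along a path made of admissible labels the bounds of
    [D] survive every edge, so no combination of labels is too fast. Conversely, the last edge of a
    foremost path in any realization carries an admissible label, so the local choice loses nothing.
    That every value is attained follows by induction on the time, since [w] is reached strictly
    before [t]. The bounds concern a concrete machine. All loops are counted loops of at most 2n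
    rounds, the length of a merge, so the time is bounded by a polynomial read off the program text
    whose degree is the nesting depth 3. The invariants then never mention time, and they speak of
    states in which scratch registers are ignored. *)

Inductive expr :=
| Num (k : nat)
| Var (x : nat)
| Op (o : binop) (e1 e2 : expr)
| Get (e : expr).

Fixpoint eval (e : expr) (h : state) : nat :=
  match e with
  | Num k => k
  | Var x => regs h x
  | Op o e1 e2 => eval_binop o (eval e1 h) (eval e2 h)
  | Get e => mem h (eval e h)
  end.

(* Registers 0, ..., ntemp - 1 are program variables, the others hold
   intermediate results. *)
Definition ntemp := 30.

(** Register [d] acts as the top of a stack: the value is left there and the registers below [d]
    stay untouched. The machine has no move instruction, so a variable is copied by adding zero. *)
Fixpoint eval_to (d : nat) (e : expr) : cmd :=
  match e with
  | Num k => Const d k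
  | Var x => Seq (Const d 0) (Bin OAdd d x d)
  | Op o e1 e2 => Seq (eval_to d e1) (Seq (eval_to d.+1 e2) (Bin o d d d.+1))
  | Get e => Seq (eval_to d e) (Read d d)
  end.

Definition Asg (x : nat) (e : expr) : cmd :=
  Seq (eval_to ntemp e) (Seq (Const ntemp.+1 0) (Bin OAdd x ntemp ntemp.+1)).

Definition Put (e1 e2 : expr) : cmd :=
  Seq (eval_to ntemp e1) (Seq (eval_to ntemp.+1 e2) (Write ntemp ntemp.+1)).

Definition IfE (e : expr) (c1 c2 : cmd) : cmd :=
  Seq (eval_to ntemp e) (If ntemp c1 c2).

Definition For (x y : nat) (c : cmd) : cmd :=
  Seq (Const x 0) (Seq (Bin OLt ntemp x y)
    (While ntemp (Seq c (Seq (Const ntemp 1)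
      (Seq (Bin OAdd x x ntemp) (Bin OLt ntemp x y)))))).

Fixpoint writes (c : cmd) : seq nat :=
  match c with
  | Skip | Write _ _ => [::]
  | Const x _ | Bin _ x _ _ | Read x _ => [:: x]
  | Seq c1 c2 | If _ c1 c2 => writes c1 ++ writes c2
  | While _ c => writes c
  end.

(* The running time if no loop makes more than [B] rounds. *)
Fixpoint cost (B : nat) (c : cmd) : nat :=
  match c with
  | Seq c1 c2 => cost B c1 + cost B c2
  | If _ c1 c2 => (cost B c1 + cost B c2).+1
  | While _ c => (B * (cost B c).+1).+1
  | _ => 1
  end.

Fixpoint depth (c : cmd) : nat :=
  match c with
  | Seq c1 c2 | If _ c1 c2 => maxn (depth c1) (depth c2)
  | While _ c => (depth c).+1
  | _ => 0
  end.

Lemma cost_poly c : exists K, forall B, cost B c <= K * B.+1 ^ depth c.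
Proof.
have mono K k m B : k <= m -> K * B.+1 ^ k <= K * B.+1 ^ m.
  by move=> km; rewrite leq_mul2l leq_pexp2l ?orbT.
elim: c => /=; try by exists 1.
- move=> c1 [K1 H1] c2 [K2 H2]; exists (K1 + K2) => B; rewrite mulnDl.
  apply: leq_add; [apply: leq_trans (H1 B) _ | apply: leq_trans (H2 B) _];
    by apply: mono; rewrite ?leq_maxl ?leq_maxr.
- move=> _ c1 [K1 H1] c2 [K2 H2]; exists (K1 + K2).+1 => B.
  rewrite mulSn mulnDl -[leqLHS]add1n; apply: leq_add; first by rewrite expn_gt0.
  apply: leq_add; [apply: leq_trans (H1 B) _ | apply: leq_trans (H2 B) _];
    by apply: mono; rewrite ?leq_maxl ?leq_maxr.
- move=> _ c [K H]; exists K.+2 => B; rewrite expnS.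
  have Bc : 0 < B.+1 ^ depth c by rewrite expn_gt0.
  by move: (H B); set X := B.+1 ^ _ in Bc *; nia.
Qed.

(** * Program logic: total correctness with a time bound *)

Section WordRAM.

Variables w s B : nat.
Let W := 2 ^ w.
Hypothesis W_gt1 : 1 < W.

(** Only sums and products can leave the word range: the other operations return a boolean or at
    most their left operand. *)
Fixpoint safe (e : expr) (h : state) : Prop :=
  match e with
  | Num k => k < W
  | Var x => x < ntemp
  | Op o e1 e2 =>
      [/\ safe e1 h, safe e2 h &
          match o with
          | OAdd | OMul => eval_binop o (eval e1 h) (eval e2 h) < W
          | _ => True
          end]
  | Get e => safe e h /\ eval e h < s
  end.

(** The abstract state [h] fixes the memory and the program variables only; scratch registers of the
    machine state may hold any word. *)
Definition represents (h st : state) : Prop :=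
  [/\ mem st = mem h, forall x, x < ntemp -> regs st x = regs h x,
      forall x, regs st x < W & forall a, mem st a < W].

(** The time bound is the static [cost], which the rules below settle once and for all; assertions
    only have to describe the abstract state. *)
Definition wp (c : cmd) (Q : state -> Prop) (h : state) : Prop :=
  forall st, represents h st -> exists t st' h',
    [/\ exec w s c st t st', t <= cost B c, represents h' st' & Q h'].

Lemma exec_frame c st t st' : exec w s c st t st' ->
  forall x, x \notin writes c -> regs st' x = regs st x.
Proof.
elim=> //=.
- by move=> x k st0 y; rewrite inE /upd => /negPf->.
- by move=> o x y z st0 a; rewrite inE /upd => /negPf->.
- by move=> x y st0 _ a; rewrite inE /upd => /negPf->.
- move=> c1 c2 st1 st2 st3 t1 t2 _ IH1 _ IH2 x; rewrite mem_cat negb_or.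
  by case/andP=> x1 x2; rewrite IH2 ?IH1.
- move=> x c1 c2 st0 t0 st1 _ _ IH y; rewrite mem_cat negb_or => /andP[? _].
  exact: IH.
- move=> x c1 c2 st0 t0 st1 _ _ IH y; rewrite mem_cat negb_or => /andP[_ ?].
  exact: IH.
- by move=> x c0 st1 st2 st3 t1 t2 _ _ IH1 _ IH2 y xc; rewrite IH2 ?IH1.
Qed.

Lemma eval_toP e d h st : ntemp <= d -> safe e h -> represents h st ->
  exists st', [/\ exec w s (eval_to d e) st (cost B (eval_to d e)) st',
    represents h st', regs st' d = eval e h &
    forall x, x < d -> regs st' x = regs st x].
Proof.
have W0 : 0 < W by apply: ltnW.
have rep h' st' d' a : ntemp <= d' -> a < W -> represents h' st' ->
    represents h' (set_reg st' d' a).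
  move=> dn aW [rm rr rW mW]; split=> //= x; last by rewrite /upd; case: eqP.
  by move=> xn; rewrite /upd ltn_eqF ?rr //; apply: leq_trans dn.
elim: e d h st => [k|x|o e1 IH1 e2 IH2|e IH] d h st dn /= se hst.
- exists (set_reg st d (k %% 2 ^ w)); split.
  + exact: EConst.
  + by apply: rep; rewrite ?ltn_mod.
  + by rewrite /= /upd eqxx modn_small.
  + by move=> x xd; rewrite /= /upd ltn_eqF.
- exists (set_reg (set_reg st d (0 %% 2 ^ w)) d
    (eval_binop OAdd (regs (set_reg st d (0 %% 2 ^ w)) x)
       (regs (set_reg st d (0 %% 2 ^ w)) d) %% 2 ^ w)); split.
  + by rewrite -[2]/(1 + 1); apply: ESeq; [apply: EConst | apply: EBin].
  + by apply: (rep); rewrite ?ltn_mod //; apply: rep; rewrite ?ltn_mod.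
  + case: hst => _ rr rW _.
    rewrite /= /upd eqxx mod0n addn0 ltn_eqF ?(leq_trans se) //.
    by rewrite modn_small ?rr // -rr //; exact: rW.
  + by move=> y yd; rewrite /= /upd ltn_eqF.
- case: se => s1 s2 so.
  have [st1 [ex1 h1 v1 f1]] := IH1 d h st dn s1 hst.
  have [st2 [ex2 h2 v2 f2]] := IH2 d.+1 h st1 (leqW dn) s2 h1.
  exists (set_reg st2 d (eval_binop o (regs st2 d) (regs st2 d.+1) %% 2 ^ w)).
  split.
  + by apply: ESeq ex1 _; apply: ESeq ex2 _; apply: EBin.
  + by apply: rep; rewrite ?ltn_mod.
  + have [v1W v2W] : eval e1 h < W /\ eval e2 h < W.
      by rewrite -v1 -v2; split; [case: h1 | case: h2].
    rewrite /= /upd eqxx v2 f2 // v1 modn_small //.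
    have bW (b : bool) : b < W by apply: leq_ltn_trans W_gt1; case: b.
    case: o so => //= _; first 1 last.
    * by apply: leq_ltn_trans v1W; apply: leq_div.
    * by apply: leq_ltn_trans v1W; apply: leq_mod.
    * by apply: leq_ltn_trans v1W; apply: leq_subr.
  + by move=> x xd; rewrite /= /upd ltn_eqF // f2 ?f1 // ltnW.
- case: se => se es; have [st1 [ex1 h1 v1 f1]] := IH d h st dn se hst.
  exists (set_reg st1 d (mem st1 (regs st1 d))); split.
  + by apply: ESeq ex1 _; apply: ERead; rewrite v1.
  + by apply: rep => //; case: h1.
  + by rewrite /= /upd eqxx v1; case: h1 => ->.
  + by move=> x xd; rewrite /= /upd ltn_eqF // f1.
Qed.

Lemma wp_mono c (P Q : state -> Prop) h :
  (forall h', P h' -> Q h') -> wp c P h -> wp c Q h.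
Proof.
move=> PQ cP st hst; have [t [st' [h' [? ? ? /PQ ?]]]] := cP st hst.
by exists t, st', h'.
Qed.

Definition framed (xs : seq nat) (h h' : state) : Prop :=
  forall x, x < ntemp -> x \notin xs -> regs h' x = regs h x.

(** An execution cannot change registers outside the syntactic list [writes c], so a specification
    need not mention them: the frame is recovered wherever the command is used. *)
Lemma wp_frame c (Q : state -> Prop) h :
  wp c (fun h' => framed (writes c) h h' -> Q h') h -> wp c Q h.
Proof.
move=> cQ st hst; have [t [st' [h' [ex ct hst' Qh']]]] := cQ st hst.
exists t, st', h'; split=> //; apply: Qh' => x xn xc.
case: hst hst' => _ r _ _ [_ r' _ _].
by rewrite -r // -r' // (exec_frame ex).
Qed.

Lemma wp_skip (Q : state -> Prop) h : Q h -> wp Skip Q h.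
Proof. by move=> Qh st hst; exists 1, st, h; split=> //; apply: ESkip. Qed.

Lemma wp_seq c1 c2 Q h : wp c1 (wp c2 Q) h -> wp (Seq c1 c2) Q h.
Proof.
move=> c12 st hst; have [t1 [st1 [h1 [ex1 ct1 hst1 c2Q]]]] := c12 st hst.
have [t2 [st2 [h2 [ex2 ct2 hst2 Qh2]]]] := c2Q st1 hst1.
by exists (t1 + t2), st2, h2; split=> //; [apply: ESeq ex1 ex2 | apply: leq_add].
Qed.

Lemma wp_asg x e (Q : state -> Prop) h :
  safe e h -> x < ntemp -> Q (set_reg h x (eval e h)) -> wp (Asg x e) Q h.
Proof.
move=> se xn Qh st hst.
have [st1 [ex1 [m1 r1 rW mW] v1 _]] := eval_toP (leqnn _) se hst.
have W0 : 0 < W by apply: ltnW.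
set st2 := set_reg st1 ntemp.+1 (0 %% 2 ^ w).
exists (cost B (Asg x e)),
  (set_reg st2 x (eval_binop OAdd (regs st2 ntemp) (regs st2 ntemp.+1) %% 2 ^ w)),
  (set_reg h x (eval e h)); split=> //.
  by apply: ESeq ex1 _; apply: ESeq; [apply: EConst | apply: EBin].
have -> : eval_binop OAdd (regs st2 ntemp) (regs st2 ntemp.+1) %% 2 ^ w = eval e h.
  by rewrite /= /upd /= mod0n addn0 v1 modn_small // -v1.
split=> //= y.
  by move=> yn; rewrite /upd; case: eqP => // _; rewrite ltn_eqF ?r1 // ltnW.
rewrite /upd; case: eqP => _; first by rewrite -v1.
by case: eqP => // _; rewrite mod0n.
Qed.

Lemma wp_put e1 e2 (Q : state -> Prop) h :
  safe e1 h -> safe e2 h -> eval e1 h < s ->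
  Q (set_mem h (eval e1 h) (eval e2 h)) -> wp (Put e1 e2) Q h.
Proof.
move=> s1 s2 es Qh st hst.
have [st1 [ex1 h1 v1 _]] := eval_toP (leqnn _) s1 hst.
have [st2 [ex2 [m2 r2 rW mW] v2 f2]] := eval_toP (leqnSn _) s2 h1.
have v1' : regs st2 ntemp = eval e1 h by rewrite f2.
exists (cost B (Put e1 e2)), (set_mem st2 (regs st2 ntemp) (regs st2 ntemp.+1)),
  (set_mem h (eval e1 h) (eval e2 h)); split=> //.
  by apply: ESeq ex1 _; apply: ESeq ex2 _; apply: EWrite; rewrite v1'.
rewrite v1' v2; split=> //=; first by rewrite m2.
by move=> a; rewrite /upd; case: eqP => // _; rewrite -v2.
Qed.

Lemma wp_if e c1 c2 (Q : state -> Prop) h : safe e h ->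
  (eval e h != 0 -> wp c1 Q h) -> (eval e h = 0 -> wp c2 Q h) ->
  wp (IfE e c1 c2) Q h.
Proof.
move=> se H1 H2 st hst.
have [st1 [ex1 h1 v1 _]] := eval_toP (leqnn _) se hst.
have [e0|e0] := eqVneq (eval e h) 0.
  have [t2 [st2 [h2 [ex2 ct2 hst2 Qh2]]]] := H2 e0 st1 h1.
  exists (cost B (eval_to ntemp e) + t2.+1), st2, h2; split=> //=; last by lia.
  by apply: ESeq ex1 _; apply: EIfFalse ex2; rewrite v1.
have [t2 [st2 [h2 [ex2 ct2 hst2 Qh2]]]] := H1 e0 st1 h1.
exists (cost B (eval_to ntemp e) + t2.+1), st2, h2; split=> //=; last by lia.
by apply: ESeq ex1 _; apply: EIfTrue ex2; rewrite v1.
Qed.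

(** The number of rounds is fixed on entry because the body writes neither [x] nor [y]. The loop
    does the increment itself, hence the invariant is demanded after [x] has been set to [k.+1]. *)
Lemma wp_for (I : nat -> state -> Prop) x y c (Q : state -> Prop) h :
  x < ntemp -> y < ntemp -> x != y -> x \notin writes c -> y \notin writes c ->
  regs h y <= B ->
  I 0 (set_reg h x 0) ->
  (forall k h', k < regs h y -> I k h' -> regs h' x = k ->
     framed (x :: writes c) h h' ->
     wp c (fun h'' => I k.+1 (set_reg h'' x k.+1)) h') ->
  (forall h', I (regs h y) h' -> framed (x :: writes c) h h' -> Q h') ->
  wp (For x y c) Q h.
Proof.
move=> xn yn xy xc yc yB I0 IS IQ st hst.
have W0 : 0 < W by apply: ltnW.
have bW (b : bool) : b < W by apply: leq_ltn_trans W_gt1; case: b.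
have setW st0 z a : (forall x, regs st0 x < W) -> a < W ->
    forall x, regs (set_reg st0 z a) x < W.
  by move=> H aW x'; rewrite /= /upd; case: (x' == z).
set b := regs h y in yB IS IQ *.
pose tail := Seq c (Seq (Const ntemp 1)
      (Seq (Bin OAdd x x ntemp) (Bin OLt ntemp x y))).
have loop m k h1 st1 : k + m = b -> I k h1 -> regs h1 x = k ->
    framed (x :: writes c) h h1 -> represents h1 st1 ->
    regs st1 ntemp = (k < b) ->
    exists t st' h', [/\ exec w s (While ntemp tail) st1 t st',
      t <= (m * (cost B tail).+1).+1, represents h' st' & Q h'].
  elim: m k h1 st1 => [|m IH] k h1 st1 kb Ik h1x fr hst1 tst1.
    rewrite addn0 in kb; rewrite kb ltnn in tst1; rewrite kb in Ik.
    exists 1, st1, h1; split=> //; last exact: IQ.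
    exact: EWhileFalse.
  have ltkb : k < b by lia.
  have [t2 [st2 [h2 [ex2 ct2 hst2 Ih2]]]] := IS k h1 ltkb Ik h1x fr st1 hst1.
  case: hst1 hst2 => m1 r1 rW1 mW1 [m2 r2 rW2 mW2].
  have x2 : regs st2 x = k by rewrite (exec_frame ex2) // r1.
  have y1 : regs h1 y = b by rewrite fr // inE negb_or eq_sym xy.
  have y2 : regs st2 y = b by rewrite (exec_frame ex2) // r1.
  (* The increment cannot overflow: the counter is bounded by register [y], which holds a word. *)
  have kW : k.+1 < W by apply: leq_ltn_trans ltkb _; rewrite -y2.
  pose st3 := set_reg st2 ntemp (1 %% 2 ^ w).
  pose st4 := set_reg st3 x (eval_binop OAdd (regs st3 x) (regs st3 ntemp) %% 2 ^ w).
  pose st5 := set_reg st4 ntemp (eval_binop OLt (regs st4 x) (regs st4 y) %% 2 ^ w).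
  have x4 : regs st4 x = k.+1.
    rewrite /= /upd eqxx ltn_eqF //= x2 (modn_small W_gt1) addn1.
    exact: modn_small.
  have y4 : regs st4 y = b.
    by rewrite /= /upd eq_sym (negPf xy) ltn_eqF.
  have n5 : regs st5 ntemp = (k.+1 < b).
    transitivity (eval_binop OLt (regs st4 x) (regs st4 y) %% 2 ^ w).
      by rewrite /= /upd eqxx.
    by rewrite x4 y4 modn_small //; apply: bW.
  have h5 : represents (set_reg h2 x k.+1) st5.
    split=> //.
    - move=> z zn; transitivity (regs st4 z).
        by rewrite /= /upd (ltn_eqF zn).
      have [->|zx] := eqVneq z x; first by rewrite x4 /= /upd eqxx.
      by rewrite /= /upd (negPf zx) (ltn_eqF zn) r2.
    - by do 3![apply: (setW); last by rewrite ltn_mod].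
  have [|||t6 [st6 [h6 [ex6 ct6 hst6 Qh6]]]] := IH k.+1 _ st5 _ Ih2 _ _ h5 n5.
  - by rewrite addSnnS.
  - by rewrite /= /upd eqxx.
  - move=> z zn; rewrite inE negb_or => /andP[zx zc].
    rewrite /= /upd (negPf zx) -r2 // (exec_frame ex2) // r1 // fr //.
    by rewrite inE negb_or zx.
  - exists ((t2 + 3) + t6).+1, st6, h6; split=> //.
    + apply: EWhileTrue ex6; first by rewrite tst1 ltkb.
      by apply: ESeq ex2 _; apply: (@ESeq _ _ _ _ _ st3 _ 1 2);
        [apply: EConst | apply: (@ESeq _ _ _ _ _ st4 _ 1 1); apply: EBin].
    + by move: ct2 ct6; rewrite /tail /= mulSn; lia.
case: hst => m0 r0 rW0 mW0.
pose st1 := set_reg st x (0 %% 2 ^ w).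
pose st2 := set_reg st1 ntemp (eval_binop OLt (regs st1 x) (regs st1 y) %% 2 ^ w).
have [|||||t [st' [h' [ex ct hst' Qh']]]] :=
    loop b 0 (set_reg h x 0) st2 _ I0 _ _ _ _.
- by rewrite add0n.
- by rewrite /= /upd eqxx.
- by move=> z zn; rewrite inE negb_or => /andP[zx _]; rewrite /= /upd (negPf zx).
- split=> //.
  + move=> z zn; rewrite /= /upd (ltn_eqF zn); case: eqP => // _; first by rewrite mod0n.
    exact: r0.
  + by do 2![apply: (setW); last by rewrite ltn_mod].
- by rewrite /= /upd !eqxx eq_sym (negPf xy) mod0n (r0 y) // modn_small //; apply: bW.
exists (1 + (1 + t)), st', h'; split=> //.
  by apply: ESeq; [apply: EConst | apply: ESeq; [apply: EBin | exact: ex]].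
have : b * (cost B tail).+1 <= B * (cost B tail).+1 by rewrite leq_mul2r yB orbT.
by rewrite /tail /= in ct *; lia.
Qed.

End WordRAM.

Arguments wp_asg {w s B}.
Arguments wp_put {w s B}.

(** * Characterization of foremost matrices *)

Definition dle (d : option nat) (t : nat) := if d is Some k then k <= t else false.
Definition dlt (d : option nat) (t : nat) := if d is Some k then k < t else false.

Section Foremost.

Variable n : nat.
Implicit Types (G : tgraph n) (D : 'M[option nat]_n) (u v x y : 'I_n).

Lemma tedgeC G u v t : tedge G u v t = tedge G v u t.
Proof. by rewrite /tedge setUC. Qed.

Lemma tedge_gt0 G u v t : tedge G u v t -> 0 < t.
Proof. by case/andP; apply: labels_gt0. Qed.

Lemma tedge_neq G u v t : tedge G u v t -> u != v.
Proof. by case/andP => /edges_card; rewrite cards2; case: (u != v). Qed.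

Lemma strict_tpath_nil G u v : strict_tpath G u v [::] = (u == v).
Proof. by rewrite /strict_tpath /= andbT. Qed.

Lemma strict_tpath_rcons G u v p y t :
  strict_tpath G u v (rcons p (y, t)) =
  [&& strict_tpath G u (last u (unzip1 p)) p,
      tedge G (last u (unzip1 p)) y t, y \notin u :: unzip1 p, y == v
    & arrival p < t].
Proof.
have [E1 E2] : unzip1 (rcons p (y, t)) = rcons (unzip1 p) y
    /\ unzip2 (rcons p (y, t)) = rcons (unzip2 p) t.
  by rewrite /unzip1 /unzip2 !map_rcons.
rewrite /strict_tpath E1 E2 rcons_path last_rcons.
have -> : (last (u, 0) p).1 = last u (unzip1 p) by rewrite -[u in RHS]/(u, 0).1 last_map.
rewrite -rcons_cons rcons_uniq eqxx.
(* For empty [p] the right-hand side asks for [0 < t], as [arrival [::]] is 0; positivity of labels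
   provides this. *)
have sE : 0 < t -> sorted ltn (rcons (unzip2 p) t) =
    sorted ltn (unzip2 p) && (arrival p < t).
  by rewrite /arrival; case: (unzip2 p) => //= a l _; rewrite rcons_path.
case: (boolP (tedge G _ y t)) => [/tedge_gt0/sE -> | _]; last by rewrite !andbF.
rewrite !andbT; case: (path _ _ _) => //=; case: (uniq _) => /=;
  last by rewrite ?andbF.
rewrite andbT.
by case: (y \notin _); case: (u \notin _); case: (y == v); case: (sorted _ _).
Qed.

Lemma arrival_rcons (p : seq ('I_n * nat)) y t : arrival (rcons p (y, t)) = t.
Proof. by rewrite /arrival /unzip2 map_rcons last_rcons. Qed.

Lemma strict_tpath_visited G u v p y : strict_tpath G u v p -> y \in u :: unzip1 p ->
  exists p', strict_tpath G u y p' /\ arrival p' <= arrival p.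
Proof.
elim/last_ind: p v y => [|p [z t] IH] v y.
  by move=> _; rewrite inE => /eqP->; exists [::]; rewrite strict_tpath_nil eqxx.
move=> pz; rewrite /unzip1 map_rcons -rcons_cons mem_rcons inE => /predU1P[->|yp].
  exists (rcons p (z, t)); split=> //; move: pz; rewrite !strict_tpath_rcons eqxx.
  by case/and5P=> -> -> -> _ ->.
move: pz; rewrite strict_tpath_rcons => /and5P[pp _ _ _ ptt].
have [p' [pp' ap']] := IH _ _ pp yp; exists p'; split=> //.
by rewrite arrival_rcons (leq_trans ap') // ltnW.
Qed.

(** Vertices on a path must be distinct. If [v] has been visited already, cutting the path at [v]
    arrives even earlier; hence only an inequality in the conclusion. *)
Lemma strict_tpath_extend G u x v p t :
  strict_tpath G u x p -> arrival p < t -> tedge G x v t ->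
  exists p', strict_tpath G u v p' /\ arrival p' <= t.
Proof.
move=> pp pt xv; have [vp|vp] := boolP (v \in u :: unzip1 p).
  have [p' [? ap']] := strict_tpath_visited pp vp; exists p'; split=> //.
  exact: leq_trans ap' (ltnW pt).
exists (rcons p (v, t)); rewrite arrival_rcons strict_tpath_rcons eqxx vp pt.
by case/and4P: (pp) => _ _ /eqP-> _; rewrite pp xv.
Qed.

Lemma Fo_le G u v p : strict_tpath G u v p -> dle (Fo G u v) (arrival p).
Proof.
move=> pp; rewrite mxE; case: eqP => // _; rewrite /min_option.
have ex0 : `[< exists p0, strict_tpath G u v p0 /\ arrival p0 = arrival p >].
  by apply/asboolP; exists p.
case: pselect => [e|[]]; last by exists (arrival p).
by rewrite /dle; case: ex_minnP => m _; apply.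
Qed.

Lemma Fo_path G u v t : Fo G u v = Some t ->
  exists p, strict_tpath G u v p /\ arrival p = t.
Proof.
rewrite mxE; case: eqP => [->|_].
  by case=> <-; exists [::]; rewrite strict_tpath_nil eqxx.
rewrite /min_option; case: pselect => // e [<-].
by case: ex_minnP => m /asboolP.
Qed.

Lemma Fo_tedge G x u v t : tedge G u v t -> dlt (Fo G x u) t -> dle (Fo G x v) t.
Proof.
move=> uv; case E: (Fo G x u) => [k|] //= kt.
have [p [pp pk]] := Fo_path E; rewrite -pk in kt.
have [p' [/Fo_le]] := strict_tpath_extend pp kt uv.
by rewrite /dle; case: (Fo G x v) => // m mp' /(leq_trans mp').
Qed.

Lemma Fo_last_tedge G u v t : u != v -> Fo G u v = Some t ->
  exists x, dlt (Fo G u x) t /\ tedge G x v t.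
Proof.
move=> uv /Fo_path[p []]; case/lastP: p => [|p [y t']].
  by rewrite strict_tpath_nil (negPf uv).
rewrite strict_tpath_rcons arrival_rcons => /and5P[pp xy _ /eqP yv pt] tt.
rewrite -tt; exists (last u (unzip1 p)); rewrite -yv; split=> //.
move: (Fo_le pp); rewrite /dle /dlt; case: (Fo G u _) => // k kp.
exact: leq_ltn_trans pt.
Qed.

(** Local certificate for a foremost matrix: the first condition on edges propagates along a path,
    so nothing beats [D]; the second yields a path by strong induction on the time, since the last
    edge starts from a vertex with a strictly smaller value. *)
Lemma FoP G D : distance_matrix D ->
  (forall x u v t, tedge G u v t -> dlt (D x u) t -> dle (D x v) t) ->
  (forall u v t, u != v -> D u v = Some t ->
     exists x, dlt (D u x) t /\ tedge G x v t) ->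
  Fo G = D.
Proof.
move=> D0 D1 D2.
have D00 u : D u u = Some 0 by apply/D0.
have sound u v p : strict_tpath G u v p -> dle (D u v) (arrival p).
  elim/last_ind: p v => [|p [y t] IH] v.
    by rewrite strict_tpath_nil => /eqP <-; rewrite D00.
  rewrite strict_tpath_rcons arrival_rcons => /and5P[pp xy _ /eqP<- pt].
  apply: D1 xy _; move: (IH _ pp); rewrite /dle /dlt; case: (D _ _) => // k kp.
  exact: leq_ltn_trans pt.
have complete t u v : D u v = Some t ->
    exists p, strict_tpath G u v p /\ arrival p = t.
  elim/ltn_ind: t u v => t IH u v uvt.
  have [E|uv] := eqVneq u v.
    move: uvt; rewrite E D00 => -[<-].
    by exists [::]; rewrite strict_tpath_nil eqxx.
  have [x []] := D2 _ _ _ uv uvt; case E: (D u x) => [k|] //= kt xv.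
  have [p [pp pk]] := IH k kt _ _ E; rewrite -pk in kt.
  have [p' [pp' p't]] := strict_tpath_extend pp kt xv.
  (* Shortening may only have lowered the arrival time, and [sound] keeps it from falling below
     [D u v]. *)
  exists p'; split=> //; apply/eqP; rewrite eqn_leq p't.
  by move: (sound _ _ _ pp'); rewrite uvt.
apply/matrixP => u v; rewrite mxE; case: eqP => [->|/eqP uv]; first by rewrite D00.
rewrite /min_option; case: pselect => [e|no].
  case: ex_minnP => m /asboolP[p [pp <-]] minm.
  move: (sound _ _ _ pp); case E: (D u v) => [t|] //= tp.
  have [q [pq qt]] := complete _ _ _ E.
  congr Some; apply/eqP; rewrite eqn_leq tp andbT.
  by apply: minm; apply/asboolP; exists q.
case E: (D u v) => [t|] //; case: no; exists t; apply/asboolP.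
exact: complete.
Qed.

(** * Temporal graphs given by lists of temporal edges *)

Implicit Type ts : seq (nat * nat * nat).

Definition triple_edge (a : nat * nat * nat) : {set 'I_n} :=
  [set x : 'I_n | (x == a.1.1 :> nat) || (x == a.1.2 :> nat)].

Lemma tgraph_of_card ts e :
  e \in [set e : {set 'I_n} | (#|e| == 2) && has (fun a => triple_edge a == e) ts] ->
  #|e| = 2.
Proof. by rewrite inE => /andP[/eqP]. Qed.

Definition triple_labels ts (e : {set 'I_n}) : seq nat :=
  [seq a.2 | a <- ts & (triple_edge a == e) && (0 < a.2)].

Lemma tgraph_of_gt0 ts (e : {set 'I_n}) t (E : {set {set 'I_n}}) :
  e \in E -> t \in seq_fset tt (triple_labels ts e) -> 0 < t.
Proof.
by move=> _; rewrite seq_fsetE => /mapP[a]; rewrite mem_filter => /andP[/andP[_ ?]] _ ->.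
Qed.

(** The filters on cardinality and on positive times make this a temporal graph for every list, so
    it is total and well-formedness of triples matters only when edges are read back. *)
Definition tgraph_of ts : tgraph n :=
  TGraph (@tgraph_of_card ts) (fun e t => @tgraph_of_gt0 ts e t _).

(** Double counting: each triple contributes to the label set of a single edge, and repetitions only
    shrink these sets. *)
Lemma nlabels_tgraph_of ts : nlabels (tgraph_of ts) <= size ts.
Proof.
rewrite /nlabels; apply: (@leq_trans
    (\sum_(e : {set 'I_n}) \sum_(a <- ts) (triple_edge a == e))).
  rewrite big_mkcond /=; apply: leq_sum => e _; case: ifP => // _.
  apply: (@leq_trans (size (triple_labels ts e))).
    by rewrite (perm_size (sort_keys_perm _)) size_undup.
  rewrite size_map size_filter -sum1_count big_mkcond /=; apply: leq_sum => a _.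
  by case: (_ == _); case: (_ < _).
rewrite exchange_big /= -sum1_size; apply: leq_sum => a _.
rewrite (bigD1 (triple_edge a)) //= eqxx big1 ?addn0 // => e.
by rewrite eq_sym => /negPf->.
Qed.

Lemma tedge_tgraph_of ts u v t :
  (forall a b t, (a, b, t) \in ts -> [/\ a < b, b < n & 0 < t]) ->
  tedge (tgraph_of ts) u v t = ((u : nat, v : nat, t) \in ts)
                            || ((v : nat, u : nat, t) \in ts).
Proof.
move=> triples_ok; rewrite /tedge.
have -> : (t \in labels (tgraph_of ts) [set u; v]) = (t \in triple_labels ts [set u; v]).
  exact: seq_fsetE.
rewrite inE.
have edgeE a b : a < b -> b < n -> (triple_edge (a, b, t) == [set u; v]) =
    ((a == u) && (b == v)) || ((a == v) && (b == u)).
  move=> ab bn; apply/eqP/idP => [E|].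
    (* Testing the two sets at [u], [v], [a] and [b] turns their equality into linear arithmetic. *)
    have := congr1 (fun A : {set 'I_n} => u \in A) E.
    have := congr1 (fun A : {set 'I_n} => v \in A) E.
    have := congr1 (fun A : {set 'I_n} => Ordinal (ltn_trans ab bn) \in A) E.
    have := congr1 (fun A : {set 'I_n} => Ordinal bn \in A) E.
    by rewrite !inE -!val_eqE /= !eqxx ?orbT /=; lia.
  by case/orP=> /andP[/eqP-> /eqP->]; apply/setP => x; rewrite !inE -!val_eqE //= orbC.
apply/idP/idP.
  case/andP=> _ /mapP[[[a b] t']]; rewrite mem_filter /= => /andP[/andP[E t0] abt] tt'.
  rewrite -{}tt' in E abt; have [ab bn _] := triples_ok _ _ _ abt.
  by move: E; rewrite edgeE // => /orP[] /andP[/eqP <- /eqP <-]; rewrite abt ?orbT.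
have main (a b : 'I_n) : (val a, val b, t) \in ts ->
    (triple_edge (val a, val b, t) == [set u; v]) ->
    [&& (#|[set u; v]| == 2), has (fun a => triple_edge a == [set u; v]) ts
      & t \in triple_labels ts [set u; v]].
  move=> abt E; have [ab bn t0] := triples_ok _ _ _ abt.
  rewrite cards2; apply/and3P; split.
  - suff -> : u != v by []; rewrite -val_eqE /=; move: E (ab); rewrite edgeE //=.
    by case/orP=> /andP[/eqP-> /eqP->]; rewrite neq_ltn => ->; rewrite ?orbT.
  - by apply/hasP; exists (val a, val b, t).
  - by apply/mapP; exists (val a, val b, t); rewrite // mem_filter E t0.
rewrite -andbA; case/orP=> abt; have [ab bn t0] := triples_ok _ _ _ abt.
  by apply: main abt _; rewrite edgeE // !eqxx.
by apply: main abt _; rewrite edgeE // !eqxx orbT.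
Qed.

Lemma lists_tgraph_of ts : uniq ts ->
  (forall a b t, (a, b, t) \in ts -> [/\ a < b, b < n & 0 < t]) ->
  lists_tgraph ts (tgraph_of ts).
Proof.
move=> ts_uniq triples_ok; split=> // a b t; split=> [abt|[u [v [-> -> uv]]]].
  have [ab bn t0] := triples_ok _ _ _ abt.
  exists (Ordinal (ltn_trans ab bn)), (Ordinal bn); split=> //.
  by rewrite tedge_tgraph_of // abt.
rewrite tedge_tgraph_of // => /orP[//|/triples_ok[vu _ _]].
by move: (ltn_trans uv vu); rewrite ltnn.
Qed.

End Foremost.

(** * The algorithm *)

(* Throughout, register 0 holds n, register 1 holds n ^ 2 and register 2 the
   number that represents infinity.  The memory consists of blocks of n ^ 2
   cells: block 0 holds D, block 1 the sorted columns (cell v * n + r is the row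
   of the entry of rank r in column v), block 2 the chosen predecessors (0 for
   none, x + 1 for x), block 3 the flags of the rows, and the output starts at
   block 4. *)

Definition At (r c : nat) : expr := Op OAdd (Op OMul (Var r) (Var 0)) (Var c).
Definition Block (k : nat) (e : expr) : expr :=
  Op OAdd (Op OMul (Num k) (Var 1)) e.

(** The largest encoded entry can serve as infinity: a finite [k] is encoded as [k.+1], hence lies
    strictly below it once decoded, and no word beyond those of the input is needed. *)
Definition max_entry : cmd :=
  For 3 0 (For 4 0
    (IfE (Op OLt (Var 2) (Get (At 3 4))) (Asg 2 (Get (At 3 4))) Skip)).

Definition convert : cmd :=
  For 3 0 (For 4 0
    (IfE (Get (At 3 4)) (Put (At 3 4) (Op OSub (Get (At 3 4)) (Num 1)))
                        (Put (At 3 4) (Var 2)))).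

(** Sum and product stand for disjunction and conjunction; the two summands exclude each other, so
    the result is 0 or 1. *)
Definition before_test : expr :=
  Op OAdd (Op OLt (Get (At 6 3)) (Get (At 4 3)))
    (Op OMul (Op OEq (Get (At 6 3)) (Get (At 4 3))) (Op OLt (Var 6) (Var 4))).

Definition sort_columns : cmd :=
  For 3 0 (For 4 0
    (Seq (Asg 5 (Num 0))
    (Seq (For 6 0 (IfE before_test (Asg 5 (Op OAdd (Var 5) (Num 1))) Skip))
         (Put (Block 1 (At 3 5)) (Var 4))))).

(* Merges the orders of columns a (register 7) and v (register 3): register 9
   points to the current row q of column v, register 10 to the current row x of
   column a, and register 11 is the maximum of column b (register 8) over the
   rows x passed so far.  A row q with D x a < D q v < D x b for some x gets
   flag 0. *)
Definition sweep_step : cmd :=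
  IfE (Op OLt (Var 9) (Var 0))
    (Seq (Asg 12 (Get (Block 1 (At 3 9))))
    (Seq (Asg 13 (Get (At 12 3)))
    (Seq (IfE (Op OLt (Var 10) (Var 0))
            (Seq (Asg 14 (Get (Block 1 (At 7 10))))
                 (Asg 15 (Op OLt (Get (At 14 7)) (Var 13))))
            (Asg 15 (Num 0)))
         (IfE (Var 15)
            (Seq (IfE (Op OLt (Var 11) (Get (At 14 8)))
                    (Asg 11 (Get (At 14 8))) Skip)
                 (Asg 10 (Op OAdd (Var 10) (Num 1))))
            (Seq (IfE (Op OLt (Var 13) (Var 11))
                    (Put (Block 3 (Var 12)) (Num 0)) Skip)
                 (Asg 9 (Op OAdd (Var 9) (Num 1))))))))
    Skip.

(** Every effective round advances exactly one of two pointers, so the 2n rounds held in register 16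
    exhaust column v; the rounds left over are idle. *)
Definition sweep : cmd :=
  Seq (Asg 9 (Num 0)) (Seq (Asg 10 (Num 0)) (Seq (Asg 11 (Num 0))
    (For 6 16 sweep_step))).

Definition set_flags : cmd := For 5 0 (Put (Block 3 (Var 5)) (Num 1)).

Definition use_flags : cmd :=
  For 5 0 (IfE (Op OMul (Op OMul (Op OLt (Num 0) (Get (Block 3 (Var 5))))
                                 (Op OLt (Get (At 5 4)) (Get (At 5 3))))
                        (Op OLt (Get (At 5 3)) (Var 2)))
             (Put (Block 2 (At 5 3)) (Op OAdd (Var 4) (Num 1))) Skip).

Definition find_preds : cmd :=
  For 3 0 (For 4 0 (IfE (Op OEq (Var 3) (Var 4)) Skip
    (Seq set_flags
    (Seq (Asg 7 (Var 4)) (Seq (Asg 8 (Var 3)) (Seq sweep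
    (Seq (Asg 7 (Var 3)) (Seq (Asg 8 (Var 4)) (Seq sweep
         use_flags))))))))).

Definition decide : cmd :=
  Seq (Asg 5 (Num 1))
  (Seq (For 3 0 (For 4 0
          (IfE (Op OMul (Op OLt (Get (At 3 4)) (Var 2))
                        (Op OEq (Get (Block 2 (At 3 4))) (Num 0)))
             (IfE (Op OEq (Var 3) (Var 4)) Skip (Asg 5 (Num 0))) Skip)))
       (Asg 0 (Var 5))).

Definition dup_step : cmd :=
  Seq (IfE (Op OMul (Op OMul (Op OLt (Var 6) (Var 3))
                             (Op OEq (Get (Block 2 (At 6 4))) (Var 5)))
                    (Op OEq (Get (At 6 4)) (Var 11))) (Asg 7 (Num 0)) Skip)
      (IfE (Op OMul (Op OMul (Op OLt (Var 10) (Var 4))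
                             (Op OEq (Get (Block 2 (At 6 10)))
                                     (Op OAdd (Var 4) (Num 1))))
                    (Op OEq (Get (At 6 10)) (Var 11))) (Asg 7 (Num 0)) Skip).

Definition put_triple : cmd :=
  Seq (Asg 9 (Block 4 (Op OMul (Num 3) (Var 8))))
  (Seq (IfE (Op OLt (Var 10) (Var 4))
          (Seq (Put (Var 9) (Var 10)) (Put (Op OAdd (Var 9) (Num 1)) (Var 4)))
          (Seq (Put (Var 9) (Var 4)) (Put (Op OAdd (Var 9) (Num 1)) (Var 10))))
  (Seq (Put (Op OAdd (Var 9) (Num 2)) (Var 11))
       (Asg 8 (Op OAdd (Var 8) (Num 1))))).

Definition emit_step : cmd :=
  Seq (Asg 5 (Get (Block 2 (At 3 4))))
    (IfE (Var 5)
       (Seq (Asg 10 (Op OSub (Var 5) (Num 1)))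
       (Seq (Asg 11 (Get (At 3 4)))
       (Seq (Asg 7 (Num 1))
       (Seq (For 6 0 dup_step)
            (IfE (Var 7) put_triple Skip))))) Skip).

Definition emit : cmd :=
  Seq (Asg 8 (Num 0))
  (Seq (For 3 0 (For 4 0 emit_step))
  (Seq (Asg 1 (Op OMul (Num 4) (Var 1)))
       (Asg 0 (Var 8)))).

Definition prepare : cmd :=
  Seq (Asg 1 (Op OMul (Var 0) (Var 0)))
  (Seq max_entry (Seq convert (Seq sort_columns
  (Seq (Asg 16 (Op OAdd (Var 0) (Var 0))) find_preds)))).

(* [e u v] is 0, or the successor of the vertex chosen before v on the way from
   u to v.  Among the pairs (u, v) that ask for the same temporal edge, exactly
   one emits it. *)
Definition dup (a e : nat -> nat -> nat) (u v x : nat) : bool :=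
  (x < u) && (e x v == e u v) && (a x v == a u v)
  || ((e u v).-1 < v) && (e x (e u v).-1 == v.+1) && (a x (e u v).-1 == a u v).

Definition emits (a e : nat -> nat -> nat) (n u v : nat) : bool :=
  (e u v != 0) && ~~ has (dup a e u v) (iota 0 n).

Definition triple (a e : nat -> nat -> nat) (u v : nat) : nat * nat * nat :=
  (minn (e u v).-1 v, maxn (e u v).-1 v, a u v).

(** Two pairs with the same triple have the same orientation or opposite ones. In the former case
    the larger row is a duplicate of the smaller; in the latter the pair whose target is the larger
    endpoint is a duplicate of the other. The condition [e u v != v.+1] keeps the endpoints
    apart. *)
Lemma emits_inj a e n u v u' v' : u < n -> u' < n -> e u v != v.+1 ->
  emits a e n u v -> emits a e n u' v' -> triple a e u v = triple a e u' v' ->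
  u = u' /\ v = v'.
Proof.
move=> un u'n ev /andP[e0 /hasPn nd] /andP[e'0 /hasPn nd'] [E1 E2 E3].
have := nd u'; have := nd' u; rewrite !mem_iota un u'n !leq0n => /(_ isT) D' /(_ isT).
have : [/\ v = v' & e u v = e u' v'] \/ [/\ v' = (e u v).-1 & (e u' v').-1 = v].
  by case: (leqP (e u v).-1 v) E1 E2; case: (leqP (e u' v').-1 v'); lia.
case=> [[vv' ee']|[v'E vE]] D.
  subst v'; split=> //; move: D D'; rewrite /dup ee' E3 !eqxx !andbT !negb_or.
  by case/andP=> D _ /andP[D' _]; lia.
have eE : e u v = v'.+1 by rewrite v'E prednK ?lt0n.
have e'E : e u' v' = v.+1 by rewrite -vE prednK ?lt0n.
exfalso; case: (ltngtP v v') => [lt|lt|vv'].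
- by move: D'; rewrite /dup e'E /= lt eE E3 !eqxx orbT.
- by move: D; rewrite /dup eE /= lt e'E E3 !eqxx orbT.
- by move: ev; rewrite eE vv' eqxx.
Qed.

(** The emitter is found by preferring the orientation whose target is the smaller endpoint, if some
    row asks for it, and taking the least row within the chosen orientation. *)
Lemma emits_cover a e n u v : (forall u v, u < n -> v < n -> e u v <= n) ->
  u < n -> v < n -> e u v != 0 ->
  exists u' v', [/\ u' < n, v' < n, emits a e n u' v' &
    triple a e u' v' = triple a e u v].
Proof.
move=> en un vn e0.
have first u0 v0 : u0 < n -> v0 < n -> e u0 v0 != 0 ->
    ((e u0 v0).-1 < v0 -> forall x, x < n ->
       ~~ ((e x (e u0 v0).-1 == v0.+1) && (a x (e u0 v0).-1 == a u0 v0))) ->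
    exists u' v', [/\ u' < n, v' < n, emits a e n u' v' &
      triple a e u' v' = triple a e u0 v0].
  move=> u0n v0n e00 no.
  have exP : exists x, (e x v0 == e u0 v0) && (a x v0 == a u0 v0).
    by exists u0; rewrite !eqxx.
  case: (ex_minnP exP) => x /andP[/eqP ex /eqP ax] minx.
  have xu0 : x <= u0 by apply: minx; rewrite !eqxx.
  exists x, v0; split=> //; first exact: leq_ltn_trans xu0 u0n.
    rewrite /emits ex e00; apply/hasPn => y; rewrite mem_iota /= => yn.
    rewrite /dup ex ax negb_or -!andbA; apply/andP; split.
      by apply/negP => /andP[yx /minx]; rewrite leqNgt yx.
    by apply/negP => /andP[lt]; apply/negP/no.
  by rewrite /triple ex ax.
have [lt|ge] := ltnP (e u v).-1 v; last first.
  by apply: first => //; rewrite ltnNge ge.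
have [/hasP[x]|/hasPn no] :=
    boolP (has (fun x => (e x (e u v).-1 == v.+1) && (a x (e u v).-1 == a u v)) (iota 0 n)).
  rewrite mem_iota /= => xn /andP[/eqP ex /eqP ax].
  have [||||u' [v' [? ? ? E]]] := first x (e u v).-1; rewrite ?ex //=.
  - by rewrite prednK ?lt0n ?en.
  - by rewrite ltnNge ltnW.
  - by exists u', v'; split=> //; rewrite E /triple ex ax /= minnC maxnC.
by apply: first => // _ x xn; apply: no; rewrite mem_iota.
Qed.

(** * Sorting a column by ranks *)

Definition before (a : nat -> nat -> nat) (v u x : nat) : bool :=
  (a x v < a u v) || (a x v == a u v) && (x < u).

Definition rank (a : nat -> nat -> nat) (n v u : nat) : nat :=
  count (before a v u) (iota 0 n).

Definition sorts_columns (n : nat) (a p : nat -> nat -> nat) : Prop :=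
  forall v, v < n -> [/\ forall r, r < n -> p v r < n,
    forall x, x < n -> exists2 r, r < n & p v r = x &
    forall r r', r <= r' -> r' < n -> a (p v r) v <= a (p v r') v].

Lemma rank_lt a n v u : u < n -> rank a n v u < n.
Proof.
move=> un; rewrite -[X in _ < X](size_iota 0) ltn_neqAle count_size andbT.
rewrite -all_count; apply/negP => /allP /(_ u); rewrite mem_iota un /before.
by rewrite !ltnn andbF; move/(_ isT).
Qed.

(** The rows before [u] and [u] itself all come before [u'], and [u] is not before itself. *)
Lemma before_rank a n v u u' : u < n -> u' < n ->
  before a v u' u -> rank a n v u < rank a n v u'.
Proof.
move=> un u'n uu'.
have eqc : count (pred1 u) (iota 0 n) = 1.
  by rewrite count_uniq_mem ?iota_uniq // mem_iota un.
have dis : count (predI (before a v u) (pred1 u)) (iota 0 n) = 0.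
  rewrite (@eq_count _ _ pred0) ?count_pred0 // => x.
  by rewrite /= andbC /before; case: eqP => //= ->; rewrite !ltnn andbF.
have := count_predUI (before a v u) (pred1 u) (iota 0 n).
rewrite dis eqc addn0 addn1 /rank => <-; apply: sub_count => x.
by case/orP=> [|/eqP-> //]; rewrite /before in uu' *; lia.
Qed.

Lemma rank_inj a n v u u' : u < n -> u' < n ->
  rank a n v u = rank a n v u' -> u = u'.
Proof.
move=> un u'n E; have [//|ne] := eqVneq u u'.
have : before a v u' u || before a v u u'.
  by rewrite /before; case: ltngtP => //=; case: ltngtP ne.
by case/orP=> [/(before_rank un u'n) | /(before_rank u'n un)]; rewrite E ltnn.
Qed.

(** An injective rank on n rows is a bijection onto the positions, so [p v] is its inverse. *)
Lemma rank_sorts n a p :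
  (forall v u, v < n -> u < n -> p v (rank a n v u) = u) -> sorts_columns n a p.
Proof.
move=> pE v vn.
have rsurj r : r < n -> exists2 u, u < n & rank a n v u = r.
  move=> rn; pose f (u : 'I_n) := Ordinal (rank_lt a v (ltn_ord u)).
  have finj : injective f.
    by move=> u u' [] /rank_inj E; apply/val_inj/E.
  have [g _ fg] := injF_bij finj; exists (g (Ordinal rn)) => //.
  by have [] := fg (Ordinal rn).
split.
- by move=> r /rsurj[u un <-]; rewrite pE.
- by move=> x xn; exists (rank a n v x); rewrite ?rank_lt ?pE.
- move=> r r' rr' r'n; have [u' u'n E'] := rsurj r' r'n.
  have [u un E] := rsurj r (leq_ltn_trans rr' r'n).
  rewrite -E -E' !pE // leqNgt; apply/negP => lt.
  have := @before_rank a n v u' u u'n un; rewrite /before lt => /(_ isT).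
  by rewrite E E' ltnNge rr'.
Qed.

(** * Row-major addresses and tactics for symbolic execution *)

Lemma idx_lt n u v : u < n -> v < n -> u * n + v < n * n.
Proof. by move=> un vn; have := leq_mul2r n u.+1 n; rewrite un orbT mulSn; lia. Qed.

Lemma idx_inj n u v u' v' : v < n -> v' < n ->
  u * n + v = u' * n + v' -> u = u' /\ v = v'.
Proof.
move=> vn v'n E; have n0 : 0 < n by case: n vn {v'n E}.
split.
  by have := congr1 (divn^~ n) E; rewrite !divnMDl // !divn_small // !addn0.
by have := congr1 (modn^~ n) E; rewrite !modnMDl !modn_small.
Qed.

Lemma idx_ltS n u v u' v' : v < n -> v' < n ->
  u * n + v < (u' * n + v').+1 ->
  u * n + v < u' * n + v' \/ u = u' /\ v = v'.
Proof. by move=> vn v'n; rewrite ltnS leq_eqVlt => /orP[/eqP/idx_inj|]; auto. Qed.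

(** Register contents are kept as equations: [look] reduces a state and rewrites with them, and
    [fetch] carries one across a framed command, its side conditions being decided by evaluation. *)
Ltac use_regs := repeat match goal with
  | H : regs ?h ?k = _ |- context [regs ?h ?k] => rewrite H end.
Ltac look := rewrite /= /upd /=; use_regs.
Ltac look_in E := rewrite /= /upd /= in E; repeat match goal with
  | H : regs ?h ?k = _ |- _ => match type of E with
     | _ = regs h k => rewrite H in E end end.
Ltac fetch fr k := let E := fresh "reg" in have E := fr k isT isT; look_in E.
Ltac safety := look; repeat split; try lia.

(** * Specifications of the program parts *)

Section Algorithm.

Variables n w : nat.
Let W := 2 ^ w.
(** Blocks 0 to 3 and at most [n ^ 2] output triples need 7 n^2 cells. As a lower bound on the word
    range, the rounded-up value also covers 2n and the numerals in the programs, even for n = 0. *)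
Definition space := 8 * n.+1 ^ 2.
Hypothesis HW : space <= W.

Local Notation wpn := (wp w space (2 * n)).

Lemma spaceE : space = 8 * (n * n) + 16 * n + 8.
Proof. by rewrite /space expnS expn1; lia. Qed.

Lemma W_ge : 8 * (n * n) + 16 * n + 8 <= 2 ^ w.
Proof. by rewrite -spaceE. Qed.

Lemma W_gt1 : 1 < 2 ^ w.
Proof. by apply: leq_trans W_ge; lia. Qed.

Lemma bool_ltW (b : bool) : b < 2 ^ w.
Proof. by apply: leq_ltn_trans W_gt1; case: b. Qed.

Lemma wp_call c (P Q : state -> Prop) h : wpn c P h ->
  (forall h', P h' -> framed (writes c) h h' -> Q h') -> wpn c Q h.
Proof. by move=> cP PQ; apply: wp_frame; apply: wp_mono cP => h' /PQ. Qed.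

(** The double loop is treated as one loop over positions [i * n + j]. As the inner counter is reset
    for each row, the invariant must be insensitive to both counters. *)
Lemma wp_for2 (I : nat -> state -> Prop) x y c (Q : state -> Prop) h :
  x < ntemp -> y < ntemp -> uniq [:: x; y; 0] ->
  all (fun z => z \notin writes c) [:: x; y; 0] -> regs h 0 = n ->
  (forall K h' k, I K h' -> I K (set_reg h' x k) /\ I K (set_reg h' y k)) ->
  I 0 h ->
  (forall i j h', i < n -> j < n -> I (i * n + j) h' ->
     regs h' x = i -> regs h' y = j -> framed [:: x, y & writes c] h h' ->
     wpn c (I (i * n + j).+1) h') ->
  (forall h', I (n * n) h' -> framed [:: x, y & writes c] h h' -> Q h') ->
  wpn (For x 0 (For y 0 c)) Q h.
Proof.
move=> xn yn; rewrite /= !inE !negb_or !andbT => /andP[/andP[xy x0] y0].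
case/and3P=> xc yc zc h0 stab I0 IS IQ.
have wE : writes (For y 0 c) =
    [:: y; ntemp] ++ writes c ++ [:: ntemp; y; ntemp] by [].
have xw : x \notin writes (For y 0 c).
  by rewrite wE !mem_cat !inE !negb_or xy xc (ltn_eqF xn).
have zw : 0 \notin writes (For y 0 c).
  by rewrite wE !mem_cat !inE !negb_or eq_sym y0 zc.
have frw z : z < ntemp -> z \notin [:: x, y & writes c] ->
    z \notin x :: writes (For y 0 c).
  move=> zn; rewrite wE !inE !mem_cat !inE !negb_or => /and3P[-> -> ->].
  by rewrite (ltn_eqF zn).
apply: (@wp_for _ _ _ W_gt1 (fun i h' => I (i * n) h')) => //.
- by rewrite h0; lia.
- by rewrite mul0n; case: (stab 0 h 0 I0).
- rewrite h0 => i h1 ni Ii h1x fr1.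
  have h10 : regs h1 0 = n by rewrite fr1 // inE negb_or eq_sym x0.
  apply: (@wp_for _ _ _ W_gt1 (fun j h' => I (i * n + j) h')) => //.
  + by rewrite h10; lia.
  + by rewrite addn0; case: (stab _ h1 0 Ii).
  + rewrite h10 => j h2 nj Ij h2y fr2.
    have h2x : regs h2 x = i by rewrite fr2 // inE negb_or xy.
    have fr : framed [:: x, y & writes c] h h2.
      move=> z zn zw'; rewrite fr2 //; last by case/norP: zw'.
      exact/fr1/frw.
    apply: wp_mono (IS i j h2 ni nj Ij h2x h2y fr) => h3 I3.
    by rewrite addnS; case: (stab _ h3 j.+1 I3).
  + rewrite h10 => h2 I2 fr2; rewrite mulSn addnC.
    by case: (stab _ h2 i.+1 I2).
- rewrite h0 => h1 I1 fr1; apply: IQ I1 _ => z zn zw'.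
  exact/fr1/frw.
Qed.

Lemma max_entryP h : regs h 0 = n ->
  wpn max_entry (fun h' => mem h' = mem h /\
    forall u v, u < n -> v < n -> mem h (u * n + v) <= regs h' 2) h.
Proof.
move=> R0; have Wge := W_ge.
apply: (@wp_for2 (fun K h' => mem h' = mem h /\ forall u v, u < n -> v < n ->
  u * n + v < K -> mem h (u * n + v) <= regs h' 2)) => //.
- move=> i j h' ni nj [mE IH] R3 R4 fr; fetch fr 0.
  have ij := idx_lt ni nj.
  apply: (wp_if W_gt1); first by safety; rewrite spaceE; lia.
    look; rewrite mE => lt.
    apply: (wp_asg W_gt1) => //; first by safety; rewrite spaceE; lia.
    look; split=> // u v un vn; rewrite mE => lK; case: (idx_ltS vn nj lK) => [ltK|[-> ->] //].
    by move: (IH u v un vn ltK) lt; lia.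
  look; rewrite mE => lt; apply: wp_skip; split=> // u v un vn.
  by move/(idx_ltS vn nj)=> [/IH|[-> ->]]; [apply | lia].
- move=> h' [mE IH] fr; split=> // u v un vn.
  exact/IH/idx_lt.
Qed.

Lemma convertP h : regs h 0 = n ->
  wpn convert (fun h' =>
    (forall u v, u < n -> v < n -> mem h' (u * n + v) =
      if mem h (u * n + v) == 0 then regs h 2 else (mem h (u * n + v)).-1) /\
    (forall a, n * n <= a -> mem h' a = mem h a)) h.
Proof.
move=> R0; have Wge := W_ge.
apply: (@wp_for2 (fun K h' =>
    (forall u v, u < n -> v < n -> u * n + v < K -> mem h' (u * n + v) =
      if mem h (u * n + v) == 0 then regs h 2 else (mem h (u * n + v)).-1) /\
    (forall a, K <= a -> mem h' a = mem h a))) => //.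
- move=> i j h' ni nj [IH IH'] R3 R4 fr; fetch fr 0; fetch fr 2.
  have ij := idx_lt ni nj.
  apply: (wp_if W_gt1); first by safety; rewrite spaceE; lia.
    look; rewrite IH' // => ne0.
    apply: (wp_put W_gt1); try by safety; rewrite spaceE; lia.
    look; rewrite IH' //; split=> [u v un vn ltK|a aK]; last first.
      by rewrite ifF ?IH' //; lia.
    case: (idx_ltS vn nj ltK) => [{}ltK|[-> ->]]; last by rewrite eqxx (negPf ne0) subn1.
    by rewrite ifF ?IH //; lia.
  look; rewrite IH' // => e0.
  apply: (wp_put W_gt1); try by safety; rewrite spaceE; lia.
  look; split=> [u v un vn ltK|a aK]; last first.
    by rewrite ifF ?IH' //; lia.
  case: (idx_ltS vn nj ltK) => [{}ltK|[-> ->]]; last by rewrite e0 !eqxx.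
  by rewrite ifF ?IH //; lia.
- by move=> h' [IH IH'] _; split=> // u v un vn; apply/IH/idx_lt.
Qed.

Lemma sort_columnsP h (a := fun u v => mem h (u * n + v)) :
  regs h 0 = n -> regs h 1 = n * n ->
  wpn sort_columns (fun h' =>
    [/\ forall v u, v < n -> u < n ->
          mem h' (n * n + (v * n + rank a n v u)) = u,
        forall x, x < n * n -> mem h' x = mem h x
      & forall x, 2 * (n * n) <= x -> mem h' x = mem h x]) h.
Proof.
move=> H0 H1; have Wge := W_ge.
apply: (@wp_for2 (fun K h' =>
    [/\ forall v u, v < n -> u < n -> v * n + u < K ->
          mem h' (n * n + (v * n + rank a n v u)) = u,
        forall x, x < n * n -> mem h' x = mem h x
      & forall x, 2 * (n * n) <= x -> mem h' x = mem h x])) => //.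
- move=> v u h1 vn un [J1 J2 J3] R3 R4 fr1; fetch fr1 0; fetch fr1 1.
  apply: wp_seq; apply: (wp_asg W_gt1) => //; first by safety.
  apply: wp_seq.
  apply: (@wp_for _ _ _ W_gt1 (fun k h' => mem h' = mem h1 /\
    regs h' 5 = rank a k v u)) => //.
  + by look; lia.
  + look => x h2 xn [m2 R5] R6 fr2; fetch fr2 0; fetch fr2 3; fetch fr2 4.
    have xv := idx_lt xn vn; have uv := idx_lt un vn.
    have tE : eval before_test h2 = before a v u x.
      look; rewrite m2 !J2 // /before /a.
      by case: ltngtP => //= _; rewrite mul1n.
    have R5S : before a v u x + regs h2 5 = rank a x.+1 v u.
      by rewrite /rank -[x.+1]addn1 iotaD count_cat /= R5 addn0 addnC.
    have cx : rank a x v u <= x.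
      by rewrite -[leqRHS](size_iota 0) count_size.
    apply: (wp_if W_gt1).
    * by safety; rewrite ?spaceE; lia.
    * rewrite tE => bt; apply: (wp_asg W_gt1) => //; first by safety; rewrite ?spaceE; lia.
      by look; split=> //; rewrite -R5S R5; lia.
    * by rewrite tE => bt; apply: wp_skip; look; split=> //; rewrite -R5S R5; lia.
  + look => h2 [m2 R5] fr2; fetch fr2 0; fetch fr2 1; fetch fr2 3; fetch fr2 4.
    have rn : rank a n v u < n by apply: rank_lt.
    have vr := idx_lt vn rn.
    apply: (wp_put W_gt1); try by safety; rewrite ?spaceE; lia.
    look; rewrite m2 mul1n; split.
    * move=> v' u' v'n u'n ltK.
      have r'n : rank a n v' u' < n by apply: rank_lt.
      case: (idx_ltS u'n un ltK) => [{}ltK|[-> ->]]; last by rewrite eqxx.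
      (* Should an earlier pair own the cell just written, injectivity of ranks makes the two rows
         equal, so the value is right. *)
      case: eqP => [E|_]; last exact: J1.
      have [] := idx_inj r'n rn (addnI E) => vv' rr'.
      by rewrite vv' in rr'; rewrite (rank_inj u'n un rr').
    * by move=> x xn; rewrite ifF ?J2 //; lia.
    * by move=> x xn; rewrite ifF ?J3 //; lia.
- move=> h' [J1 J2 J3] _; split=> // v u vn un.
  exact/J1/idx_lt.
Qed.

Definition stores (a p : nat -> nat -> nat) (m : nat -> nat) : Prop :=
  (forall u v, u < n -> v < n -> m (u * n + v) = a u v) /\
  (forall v r, v < n -> r < n -> m (n * n + (v * n + r)) = p v r).

Lemma stores_eq a p m m' : (forall x, x < 2 * (n * n) -> m' x = m x) ->
  stores a p m -> stores a p m'.
Proof.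
move=> mE [Ha Hp]; split=> u v un vn; have uv := idx_lt un vn.
  by rewrite mE ?Ha //; lia.
by rewrite mE ?Hp //; lia.
Qed.

(** The half of the criterion for the label [a u v] that concerns crossing the edge from [ka] to
    [kb]. *)
Definition no_jump (a : nat -> nat -> nat) (v ka kb u : nat) : Prop :=
  forall x, x < n -> a x ka < a u v -> a x kb <= a u v.

(** Column [v] is read in increasing order, so rows of column [ka] passed for one row stay below all
    later times and no pointer moves back. Flags are only ever cleared, so successive sweeps combine
    into a conjunction. *)
Lemma sweepP a p v ka kb h : sorts_columns n a p -> stores a p (mem h) ->
  v < n -> ka < n -> kb < n ->
  regs h 0 = n -> regs h 1 = n * n -> regs h 3 = v -> regs h 7 = ka ->
  regs h 8 = kb -> regs h 16 = 2 * n ->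
  wpn sweep (fun h' =>
    (forall x, x < 3 * (n * n) -> mem h' x = mem h x) /\
    (forall u, u < n -> mem h' (3 * (n * n) + u) != 0 <->
       mem h (3 * (n * n) + u) != 0 /\ no_jump a v ka kb u)) h.
Proof.
move=> sorted_p st_h vn kan kbn H0 H1 H3 H7 H8 H16; have Wge := W_ge.
have [pn psurj psort] := sorted_p v vn.
have [pan pasurj pasort] := sorted_p ka kan.
do 3![apply: wp_seq; apply: (wp_asg W_gt1) => //; first by safety].
apply: (@wp_for _ _ _ W_gt1 (fun k h' => exists i j m,
  [/\ [/\ regs h' 9 = i, regs h' 10 = j & regs h' 11 = m],
      [/\ i <= n, j <= n & i < n -> i + j = k],
      [/\ forall j', j' < j -> a (p ka j') kb <= m,
          m = 0 \/ exists2 j', j' < j & m = a (p ka j') kb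
        & forall j', j' < j -> i < n -> a (p ka j') ka < a (p v i) v],
      forall x, x < 3 * (n * n) -> mem h' x = mem h x
    & forall u, u < n -> mem h' (3 * (n * n) + u) != 0 <->
       mem h (3 * (n * n) + u) != 0 /\
       forall i', i' < i -> p v i' = u -> no_jump a v ka kb u])) => //.
- by look.
- exists 0, 0, 0; split=> //; first by split=> //; left.
  by move=> u un; split=> [|[]].
- look => k h1 kn [i [j [m [[R9 R10 R11] [ni nj ij] [K1 K2 K3] J J']]]] R6 fr.
  fetch fr 0; fetch fr 1; fetch fr 3; fetch fr 7; fetch fr 8.
  have [Ha Hp] : stores a p (mem h1).
    by apply: stores_eq st_h => x xn; apply: J; lia.
  apply: (wp_if W_gt1); first by safety.
    look; case: ltnP => // i_n _; have qn := pn i i_n.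
    have vi := idx_lt vn i_n; have qv := idx_lt qn vn.
    apply: wp_seq; apply: (wp_asg W_gt1) => //; first by safety; rewrite ?spaceE; lia.
    rewrite {1}/eval /= -/eval; use_regs; rewrite mul1n Hp //.
    apply: wp_seq; apply: (wp_asg W_gt1) => //; first by safety; rewrite ?spaceE; lia.
    rewrite {1}/eval /= -/eval /upd /=; use_regs; rewrite Ha //.
    set q := p v i in qn qv K3 *; set t := a q v in K3 *.
    apply: wp_seq.
    apply: (@wp_call _ (fun h' => [/\ mem h' = mem h1,
      regs h' 15 != 0 -> [/\ j < n, regs h' 14 = p ka j & a (p ka j) ka < t]
      & regs h' 15 = 0 -> j < n -> t <= a (p ka j) ka])).
      apply: (wp_if W_gt1); first by safety.
        look; case: ltnP => // j_n _; have xn := pan j j_n.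
        have kj := idx_lt kan j_n; have xk := idx_lt xn kan.
        apply: wp_seq; apply: (wp_asg W_gt1) => //; first by safety; rewrite ?spaceE; lia.
        apply: (wp_asg W_gt1) => //.
          by safety; rewrite ?mul1n ?Hp // ?spaceE; lia.
        look; rewrite mul1n Hp // Ha //; split=> //; case: ltnP => //.
      look; case: ltnP => // j_n _.
      by apply: (wp_asg W_gt1) => //; safety.

    move=> h2 [m2 go1 go0] fr2.
    fetch fr2 0; fetch fr2 1; fetch fr2 3; fetch fr2 7; fetch fr2 8.
    fetch fr2 9; fetch fr2 10; fetch fr2 11; fetch fr2 12; fetch fr2 13.
    apply: (wp_if W_gt1) => // [/go1[j_n Rx lt]|go].
      have xn := pan j j_n; have xk := idx_lt xn kbn.
      apply: wp_seq.
      apply: (@wp_call _ (fun h' => mem h' = mem h1 /\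
          regs h' 11 = maxn m (a (p ka j) kb))).
        apply: (wp_if W_gt1); first by safety; rewrite ?spaceE; lia.
          look; rewrite m2 Ha // => ltm.
          apply: (wp_asg W_gt1) => //; first by safety; rewrite ?spaceE; lia.
          by look; rewrite m2 Ha //; split=> //; lia.
        look; rewrite m2 Ha // => ltm; apply: wp_skip; split=> //.
        by use_regs; lia.
      move=> h3 [m3 R11'] fr3; fetch fr3 9; fetch fr3 10.
      apply: (wp_asg W_gt1) => //; first by safety; lia.
      look; exists i, j.+1, (maxn m (a (p ka j) kb)); rewrite m3 addn1.
      split=> //.
      - by split=> // /ij; lia.
      - split.
        + move=> j'; rewrite ltnS leq_eqVlt => /predU1P[->|/K1]; lia.
        + case: (leqP m (a (p ka j) kb)) => _; first by right; exists j.
          by case: K2 => [->|[j' j'j E]]; [left | right; exists j'; rewrite // ltnW].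
        + by move=> j'; rewrite ltnS leq_eqVlt => /predU1P[->|/K3].
    (* No further row of column [ka] lies below [t], so by sortedness the passed rows are exactly
       those with [a x ka < t], and [m] is the maximum of [a x kb] over them, or 0 if there are
       none. *)
    have mtP : no_jump a v ka kb q <-> m <= t.
      split=> [nj'|mt x xn xt].
        case: K2 => [->//|[j' j'j ->]]; apply: nj'; last exact: K3.
        by apply: pan; apply: leq_trans nj.
      have [j' j'n j'x] := pasurj x xn.
      apply: leq_trans mt; rewrite -j'x; apply: K1; rewrite ltnNge; apply/negP => jj'.
      have := leq_trans (go0 go (leq_ltn_trans jj' j'n)) (pasort _ _ jj' j'n).
      by rewrite j'x leqNgt xt.
    apply: wp_seq.
    apply: (@wp_call _ (fun h' => (forall x, x < 3 * (n * n) -> mem h' x = mem h1 x) /\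
        forall u, u < n -> mem h' (3 * (n * n) + u) =
          if (u == q) && (t < m) then 0 else mem h1 (3 * (n * n) + u))).
      have nnn : q < n * n by apply: leq_trans qn _; nia.
      apply: (wp_if W_gt1); first by safety.
        look => tm; have {}tm : t < m by lia.
        apply: (wp_put W_gt1); try by safety; rewrite ?spaceE; lia.
        look; rewrite m2; split=> x xn; first by rewrite ifF //; lia.
        by rewrite eqn_add2l tm andbT.
      look => tm; have {}tm : (t < m) = false by lia.
      apply: wp_skip; rewrite tm m2; split=> // u un.
      by rewrite andbF.
    move=> h3 [m3 m3'] fr3; fetch fr3 9; fetch fr3 10; fetch fr3 11.
    apply: (wp_asg W_gt1) => //; first by safety; lia.
    look; exists i.+1, j, m; rewrite addn1; split=> //.
    - by split=> // i1; rewrite addSn ij.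
    - split=> // j' j'j i1; apply: leq_trans (K3 _ j'j i_n) _.
      exact: psort.
    - by move=> x xn; rewrite m3 ?J.
    - move=> u un; rewrite m3' //; have [uq|uq] /= := eqVneq u q.
        rewrite -uq in mtP; case: ltnP => tm.
          split=> // -[_ /(_ i (leqnn _) (esym uq)) /mtP].
          by rewrite leqNgt tm.
        rewrite J' //; split=> -[f0 H]; split=> // i' i'i.
          by move=> _; apply/mtP.
        by apply: H; apply: leqW.
      rewrite J' //; split=> -[f0 H]; split=> // i'.
        rewrite ltnS leq_eqVlt => /predU1P[->|/H //].
        by move=> E; rewrite -E eqxx in uq.
      by move=> i'i; apply: H; apply: leqW.
  look; case: ltnP => // i_n _; apply: wp_skip.
  have iE : i = n by lia.
  exists i, j, m; split=> //; split=> //; lia.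
- look => h1 [i [j [m [[R9 R10 R11] [ni nj ij] [K1 K2 K3] J J']]]] fr.
  (* With [i < n], the equation [i + j = 2 * n] would contradict [j <= n]. *)
  have iE : i = n by case: (ltnP i n) => [/ij|]; lia.
  split=> // u un; rewrite J' //; split=> -[f0 nj']; split=> //.
  by have [r rn ru] := psurj u un; apply: (nj' r); rewrite ?iE.
Qed.

Definition good (a : nat -> nat -> nat) (inf u v x : nat) : Prop :=
  [/\ x != v, a u x < a u v, a u v < inf, no_jump a v x v u & no_jump a v v x u].

(* The entry found for row u and column v once the first K pairs (column, row),
   in lexicographic order, have been tried. *)
Definition pred_entry a inf K u v e : Prop :=
  (e = 0 /\ forall x, x < n -> v * n + x < K -> ~ good a inf u v x) \/
  exists x, [/\ x < n, v * n + x < K, e = x.+1 & good a inf u v x].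

(** The trial numbered [v * n + x] concerns column [v] only; entries of other columns pass to the
    next number unchanged. *)
Lemma pred_entryS a inf v x u c e : x < n ->
  (c = v -> ~ good a inf u v x) ->
  pred_entry a inf (v * n + x) u c e -> pred_entry a inf (v * n + x).+1 u c e.
Proof.
move=> xn ng [[-> H]|[y [yn yK -> yg]]]; [left | right].
  split=> // y yn /(idx_ltS yn xn)[]; first exact: H.
  by case=> cv ->; move: (ng cv); rewrite cv.
by exists y; split=> //; apply: ltnW.
Qed.

Lemma set_flagsP h : regs h 0 = n -> regs h 1 = n * n ->
  wpn set_flags (fun h' =>
    (forall x, x < 3 * (n * n) -> mem h' x = mem h x) /\
    (forall u, u < n -> mem h' (3 * (n * n) + u) = 1)) h.
Proof.
move=> H0 H1; have Wge := W_ge.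
apply: (@wp_for _ _ _ W_gt1 (fun k h' =>
    (forall x, x < 3 * (n * n) -> mem h' x = mem h x) /\
    (forall u, u < k -> mem h' (3 * (n * n) + u) = 1))) => //.
- by rewrite H0; lia.
- rewrite H0 => k h1 kn [J1 J2] R5 fr; fetch fr 0; fetch fr 1.
  have knn : k < n * n by nia.
  apply: (wp_put W_gt1); try by safety; rewrite ?spaceE; lia.
  look; split=> [x xn|u]; first by rewrite ifF ?J1 //; lia.
  by rewrite eqn_add2l ltnS leq_eqVlt; case: eqP => //= _ /J2.
- by rewrite H0 => h1 [J1 J2] _.
Qed.

(** A later candidate may overwrite an earlier one, which [pred_entry] permits: any good predecessor
    will do. *)
Lemma use_flagsP a p inf v x h (K := v * n + x) : stores a p (mem h) ->
  v < n -> x < n -> x != v ->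
  regs h 0 = n -> regs h 1 = n * n -> regs h 2 = inf -> regs h 3 = v ->
  regs h 4 = x ->
  (forall u, u < n -> mem h (3 * (n * n) + u) != 0 <->
     no_jump a v x v u /\ no_jump a v v x u) ->
  (forall u c, u < n -> c < n ->
     pred_entry a inf K u c (mem h (2 * (n * n) + (u * n + c)))) ->
  wpn use_flags (fun h' => (forall y, y < 2 * (n * n) -> mem h' y = mem h y) /\
    (forall u c, u < n -> c < n ->
       pred_entry a inf K.+1 u c (mem h' (2 * (n * n) + (u * n + c))))) h.
Proof.
move=> st_h vn xn xv H0 H1 H2 H3 H4 flagP preds; have Wge := W_ge.
apply: (@wp_for _ _ _ W_gt1 (fun k h' =>
  [/\ forall y, y < 2 * (n * n) -> mem h' y = mem h y,
      forall u, u < n -> mem h' (3 * (n * n) + u) = mem h (3 * (n * n) + u)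
    & forall u c, u < n -> c < n ->
       pred_entry a inf (if u < k then K.+1 else K) u c
         (mem h' (2 * (n * n) + (u * n + c)))])) => //.
- by rewrite H0; lia.
- rewrite H0 => k h1 kn [J1 J2 J3] R5 fr.
  fetch fr 0; fetch fr 1; fetch fr 2; fetch fr 3; fetch fr 4.
  have [Ha Hp] := stores_eq J1 st_h.
  have knn : k < n * n by nia.
  have kx := idx_lt kn xn; have kv := idx_lt kn vn.
  apply: (wp_if W_gt1).
  + by look; rewrite !mulnb; repeat split; try exact: bool_ltW; rewrite ?spaceE; lia.
  + look; rewrite !Ha // J2 // !mulnb eqb0 negbK lt0n => T.
    have kg : good a inf k v x.
      case/andP: T => /andP[/(flagP _ kn)[nj1 nj2] lt1] lt2.
      exact: And5.
    apply: (wp_put W_gt1); try by safety; rewrite ?spaceE; lia.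
    look; split=> [y yn|u un|u c un cn].
    * by rewrite ifF ?J1 //; lia.
    * by rewrite ifF ?J2 //; lia.
    * rewrite eqn_add2l; case: eqP => [/(idx_inj cn vn)[-> ->]|ne].
        by rewrite ltnSn; right; exists x; split; rewrite // addn1.
      rewrite ltnS leq_eqVlt; case: eqP => [uk|_]; last exact: J3.
      apply: pred_entryS => //; last by have := J3 u c un cn; rewrite uk ltnn.
      by move=> cv; case: ne; rewrite uk cv.
  + look; rewrite !Ha // J2 // !mulnb => T.
    apply: wp_skip; split=> // u c un cn.
    have := J3 u c un cn; rewrite ltnS (leq_eqVlt u k).
    case: eqP => [->|_] //=; rewrite ltnn; apply: pred_entryS => // _ [_ lt1 lt2 nj1 nj2].
    move: T; rewrite lt1 lt2 lt0n.
    by have /(flagP _ kn) -> : no_jump a v x v k /\ no_jump a v v x k by [].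
- rewrite H0 => h1 [J1 J2 J3] _; split=> // u c un cn.
  by have := J3 u c un cn; rewrite un.
Qed.

Lemma find_predsP a p inf h : sorts_columns n a p -> stores a p (mem h) ->
  regs h 0 = n -> regs h 1 = n * n -> regs h 2 = inf -> regs h 16 = 2 * n ->
  (forall y, 2 * (n * n) <= y -> mem h y = 0) ->
  wpn find_preds (fun h' => (forall y, y < 2 * (n * n) -> mem h' y = mem h y) /\
    (forall u c, u < n -> c < n ->
       pred_entry a inf (n * n) u c (mem h' (2 * (n * n) + (u * n + c))))) h.
Proof.
move=> sorted_p st_h H0 H1 H2 H16 mem0; have Wge := W_ge.
apply: (@wp_for2 (fun K h' =>
  (forall y, y < 2 * (n * n) -> mem h' y = mem h y) /\
  (forall u c, u < n -> c < n ->
     pred_entry a inf K u c (mem h' (2 * (n * n) + (u * n + c)))))) => //.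
- by split=> // u c un cn; left; rewrite mem0 ?leq_addr.
- move=> v x h1 vn xn [J1 J2] R3 R4 fr.
  fetch fr 0; fetch fr 1; fetch fr 2; fetch fr 16.
  apply: (wp_if W_gt1); first by safety.
    look => vx; have {}vx : v = x by lia.
    apply: wp_skip; split=> // u c un cn; apply: pred_entryS; rewrite ?J2 //.
      by move=> _ []; rewrite vx eqxx.
    exact: J2.
  look => vx; have {}vx : x != v by lia.
  apply: wp_seq; apply: wp_call; first exact: set_flagsP.
  move=> h2 [m2 f2] fr2; fetch fr2 0; fetch fr2 1; fetch fr2 2; fetch fr2 16.
  fetch fr2 3; fetch fr2 4.
  have m2' y : y < 2 * (n * n) -> mem h2 y = mem h y.
    by move=> yn; rewrite m2 ?J1 //; lia.
  do 2![apply: wp_seq; apply: (wp_asg W_gt1) => //; look].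
  apply: wp_seq; apply: wp_call.
    by apply: (@sweepP a p v x v); look => //; apply: stores_eq st_h.
  move=> h3 [m3 f3] fr3; fetch fr3 0; fetch fr3 1; fetch fr3 2; fetch fr3 16.
  fetch fr3 3; fetch fr3 4.
  do 2![apply: wp_seq; apply: (wp_asg W_gt1) => //; look].
  have m3' y : y < 2 * (n * n) -> mem h3 y = mem h y.
    by move=> yn; rewrite m3 ?m2' //=; lia.
  apply: wp_seq; apply: wp_call.
    by apply: (@sweepP a p v v x); look => //; apply: stores_eq st_h.
  move=> h4 [m4 f4] fr4; fetch fr4 0; fetch fr4 1; fetch fr4 2; fetch fr4 16.
  fetch fr4 3; fetch fr4 4.
  have m4' y : y < 2 * (n * n) -> mem h4 y = mem h y.
    by move=> yn; rewrite m4 ?m3' //=; lia.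
  apply: (@wp_call _ _ _ _ (@use_flagsP a p inf v x h4 _ _ _ _ _ _ _ _ _ _ _)) => //.
  + exact: stores_eq st_h.
  (* All flags start at 1 and each sweep clears those failing in its direction, so a surviving flag
     certifies both directions. *)
  + move=> u un; rewrite f4 //= f3 //= f2 //.
    by split=> [[[_ ? ?]]|[? ?]].
  + move=> u c un cn; have uc := idx_lt un cn.
    have -> : mem h4 (2 * (n * n) + (u * n + c)) = mem h1 (2 * (n * n) + (u * n + c)).
      by rewrite m4 ?m3 ?m2 //=; lia.
    exact: J2.
  + by move=> h5 [m5 J5] _; split=> // y yn; rewrite m5 ?m4'.
Qed.

Lemma decideP a e inf h :
  (forall u v, u < n -> v < n -> mem h (u * n + v) = a u v) ->
  (forall u v, u < n -> v < n -> mem h (2 * (n * n) + (u * n + v)) = e u v) ->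
  regs h 0 = n -> regs h 1 = n * n -> regs h 2 = inf ->
  wpn decide (fun h' => exists2 b : bool, regs h' 0 = b & b <->
    forall u v, u < n -> v < n -> u != v -> a u v < inf -> e u v != 0) h.
Proof.
move=> Ha He H0 H1 H2; have Wge := W_ge.
apply: wp_seq; apply: (wp_asg W_gt1) => //; first by safety.
apply: wp_seq; apply: (@wp_for2 (fun K h' => mem h' = mem h /\
  exists2 b : bool, regs h' 5 = b & b <->
    forall u v, u < n -> v < n -> u * n + v < K -> u != v -> a u v < inf ->
      e u v != 0)) => //.
- by split=> //; exists true.
- move=> i j h1 ni nj [m1 [b R5 bP]] R3 R4 fr; fetch fr 0; fetch fr 1; fetch fr 2.
  have ij := idx_lt ni nj.
  have okK : ((a i j < inf) && (e i j == 0) -> i = j) -> b <->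
      forall u v, u < n -> v < n -> u * n + v < (i * n + j).+1 -> u != v ->
        a u v < inf -> e u v != 0.
    move=> ok; rewrite bP; split=> H u v un vn ltK.
      case: (idx_ltS vn nj ltK) => [{}ltK|[-> -> ij' lt]]; first exact: H.
      apply/negP => e0; case/eqP: ij'; apply: ok.
      by rewrite lt.
    by apply: H => //; apply: ltnW.
  apply: (wp_if W_gt1).
  + by look; rewrite !mulnb; repeat split; try exact: bool_ltW; rewrite ?spaceE; lia.
  + look; rewrite m1 Ha // He // mulnb eqb0 negbK => T.
    apply: (wp_if W_gt1); first by safety.
      look => ij'; apply: wp_skip; split=> //; exists b => //.
      by apply: okK => _; lia.
    look => ij'; apply: (wp_asg W_gt1) => //; first by safety.
    look; split=> //; exists false => //; split=> // H.
    have ne : i != j by lia.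
    by case/andP: T => /(H i j ni nj (ltnSn _) ne)/negPf->.
  + look; rewrite m1 Ha // He // mulnb => T; apply: wp_skip; split=> //.
    by exists b => //; apply: okK => T'; rewrite T' in T.
- move=> h1 [m1 [b R5 bP]] _; apply: (wp_asg W_gt1) => //.
  look; exists b => //; rewrite bP; split=> H u v un vn; last by move=> _; apply: H.
  by apply: H => //; apply: idx_lt.
Qed.

Lemma dup_loopP a e u v h :
  (forall u v, u < n -> v < n -> mem h (u * n + v) = a u v) ->
  (forall u v, u < n -> v < n -> mem h (2 * (n * n) + (u * n + v)) = e u v) ->
  u < n -> v < n -> (e u v).-1 < n -> e u v != 0 ->
  regs h 0 = n -> regs h 1 = n * n -> regs h 3 = u -> regs h 4 = v ->
  regs h 5 = e u v -> regs h 10 = (e u v).-1 -> regs h 11 = a u v ->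
  regs h 7 = 1 ->
  wpn (For 6 0 dup_step) (fun h' => mem h' = mem h /\
    regs h' 7 = emits a e n u v) h.
Proof.
move=> Ha He un vn wn e0 H0 H1 H3 H4 H5 H10 H11 H7; have Wge := W_ge.
apply: (@wp_for _ _ _ W_gt1 (fun k h' => mem h' = mem h /\
  regs h' 7 = emits a e k u v)) => //.
- by rewrite H0; lia.
- by split=> //; rewrite /emits e0 [regs _ 7]H7.
- rewrite H0 => x h1 xn [m1 R7] R6 fr.
  fetch fr 0; fetch fr 1; fetch fr 3; fetch fr 4; fetch fr 5; fetch fr 10; fetch fr 11.
  have xv := idx_lt xn vn; have xw := idx_lt xn wn.
  apply: wp_seq.
  apply: (@wp_call _ (fun h' => mem h' = mem h /\ regs h' 7 =
      emits a e x u v && ~~ ((x < u) && (e x v == e u v) && (a x v == a u v)))).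
    apply: (wp_if W_gt1).
    + by look; rewrite !mulnb; repeat split; try exact: bool_ltW; rewrite ?spaceE; lia.
    + look; rewrite m1 Ha // He // !mulnb eqb0 negbK => T.
      apply: (wp_asg W_gt1) => //; first by safety.
      by look; split=> //; rewrite T andbF.
    + look; rewrite m1 Ha // He // !mulnb => /eqP; rewrite eqb0 => /negPf T.
      by apply: wp_skip; split=> //; rewrite R7 T andbT.
  move=> h2 [m2 R7'] fr2.
  fetch fr2 0; fetch fr2 1; fetch fr2 3; fetch fr2 4; fetch fr2 5; fetch fr2 6.
  fetch fr2 10; fetch fr2 11.
  have emitsS : emits a e x.+1 u v = emits a e x u v && ~~ dup a e u v x.
    by rewrite /emits -[x.+1]addn1 iotaD has_cat /= orbF negb_or andbA.
  apply: (wp_if W_gt1).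
  + by look; rewrite !mulnb; repeat split; try exact: bool_ltW; rewrite ?spaceE; lia.
  + look; rewrite m2 Ha // He // !mulnb addn1 eqb0 negbK => T.
    apply: (wp_asg W_gt1) => //; first by safety.
    by look; split=> //; rewrite emitsS /dup T orbT andbF.
  + look; rewrite m2 Ha // He // !mulnb addn1 => /eqP; rewrite eqb0 => /negPf T.
    by apply: wp_skip; look; split=> //; rewrite emitsS /dup T orbF.
- by rewrite H0.
Qed.

Lemma put_tripleP k a e u v h :
  k < n * n -> regs h 1 = n * n -> regs h 4 = v -> regs h 8 = k ->
  regs h 10 = (e u v).-1 -> regs h 11 = a u v ->
  wpn put_triple (fun h' => [/\ regs h' 8 = k.+1,
    forall x, x < 4 * (n * n) + 3 * k -> mem h' x = mem h x &
    let b := 4 * (n * n) + 3 * k in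
    (mem h' b, mem h' b.+1, mem h' b.+2) = triple a e u v]) h.
Proof.
move=> kn H1 H4 H8 H10 H11; have Wge := W_ge.
apply: wp_seq; apply: (wp_asg W_gt1) => //; first by safety.
apply: wp_seq.
set b := 4 * (n * n) + 3 * k.
apply: (@wp_call _ (fun h' => [/\ forall x, x < b -> mem h' x = mem h x,
    mem h' b = minn (e u v).-1 v & mem h' b.+1 = maxn (e u v).-1 v])).
  apply: (wp_if W_gt1); first by safety.
    look => T; apply: wp_seq; apply: (wp_put W_gt1); try by safety; rewrite ?spaceE; lia.
    apply: (wp_put W_gt1); try by safety; rewrite ?spaceE; lia.
    look; rewrite addn1 -/b; split.
    - by move=> x xb; rewrite !ifF //; lia.
    - by rewrite eqxx ifF; lia.
    - by rewrite eqxx; lia.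
  look => T; apply: wp_seq; apply: (wp_put W_gt1); try by safety; rewrite ?spaceE; lia.
  apply: (wp_put W_gt1); try by safety; rewrite ?spaceE; lia.
  look; rewrite addn1 -/b; split.
  - by move=> x xb; rewrite !ifF //; lia.
  - by rewrite eqxx ifF; lia.
  - by rewrite eqxx; lia.
move=> h1 [m1 mb mb1] fr; fetch fr 8; fetch fr 9; fetch fr 11.
apply: wp_seq; apply: (wp_put W_gt1); try by safety; rewrite ?spaceE; lia.
apply: (wp_asg W_gt1) => //; first by safety; lia.
look; rewrite addn1 addn2 -/b eqxx; split=> //.
- by move=> x xb; rewrite ifF ?m1 //; lia.
- by rewrite !ifF; [rewrite mb mb1 | lia | lia].
Qed.

Lemma emitP a e h :
  (forall u v, u < n -> v < n -> mem h (u * n + v) = a u v) ->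
  (forall u v, u < n -> v < n -> mem h (2 * (n * n) + (u * n + v)) = e u v) ->
  (forall u v, u < n -> v < n -> e u v <= n) ->
  (forall u v, u < n -> v < n -> e u v != v.+1) ->
  regs h 0 = n -> regs h 1 = n * n ->
  wpn emit (fun h' => exists ts, [/\ output_triples h' = ts,
    uniq ts, size ts <= n * n /\ output_within space h' &
    forall x, x \in ts <-> exists u v,
      [/\ u < n, v < n, emits a e n u v & x = triple a e u v]]) h.
Proof.
move=> Ha He pred_le pred_neq H0 H1; have Wge := W_ge.
apply: wp_seq; apply: (wp_asg W_gt1) => //; first by safety.
apply: wp_seq; apply: (@wp_for2 (fun K h' => exists ts,
  [/\ regs h' 8 = size ts /\ (forall x, x < 4 * (n * n) -> mem h' x = mem h x),
    forall i, i < size ts -> let b := 4 * (n * n) + 3 * i in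
      (mem h' b, mem h' b.+1, mem h' b.+2) = nth (0, 0, 0) ts i,
    uniq ts, size ts <= K &
    forall x, x \in ts <-> exists u v,
      [/\ u < n, v < n, u * n + v < K, emits a e n u v & x = triple a e u v]])) => //.
- exists [::]; split=> // x; split=> // -[u [v []]] //.
- move=> u v h1 un vn [ts [[R8 m1] out ts_u ts_K tsP]] R3 R4 fr.
  fetch fr 0; fetch fr 1; have uv := idx_lt un vn.
  have Ha1 u0 v0 : u0 < n -> v0 < n -> mem h1 (u0 * n + v0) = a u0 v0.
    by move=> u0n v0n; have lt := idx_lt u0n v0n; rewrite m1 ?Ha //; lia.
  have He1 u0 v0 : u0 < n -> v0 < n -> mem h1 (2 * (n * n) + (u0 * n + v0)) = e u0 v0.
    by move=> u0n v0n; have lt := idx_lt u0n v0n; rewrite m1 ?He //; lia.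
  have skipP : ~~ emits a e n u v -> forall x, x \in ts <-> exists u0 v0,
      [/\ u0 < n, v0 < n, u0 * n + v0 < (u * n + v).+1, emits a e n u0 v0
        & x = triple a e u0 v0].
    move=> ne x; rewrite tsP; split=> -[u0 [v0 [u0n v0n ltK em xE]]].
      by exists u0, v0; split=> //; apply: ltnW.
    case: (idx_ltS v0n vn ltK) => [{}ltK|[eu ev]]; first by exists u0, v0.
    by rewrite -eu -ev em in ne.
  apply: wp_seq; apply: (wp_asg W_gt1) => //; first by safety; rewrite ?spaceE; lia.
  rewrite {1}/eval /= -/eval; use_regs; rewrite He1 //.
  apply: (wp_if W_gt1) => //.
    look => e0; have wn : (e u v).-1 < n by have := pred_le u v un vn; lia.
    do 3![apply: wp_seq; apply: (wp_asg W_gt1) => //;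
      first by safety; rewrite ?spaceE; lia].
    apply: wp_seq; apply: wp_call.
      by apply: (@dup_loopP a e u v); look; rewrite ?Ha1 // ?subn1.
    look => h2 [m2 R7] fr2.
    fetch fr2 1; fetch fr2 4; fetch fr2 8; fetch fr2 10; fetch fr2 11.
    rewrite subn1 in reg4; rewrite Ha1 // in reg5.
    apply: (wp_if W_gt1) => //; look.
      rewrite eqb0 negbK => em.
      apply: wp_call; first by apply: (@put_tripleP (size ts) a e u v) => //; lia.
      move=> h3 [R8' m3 out3] _; exists (rcons ts (triple a e u v)).
      rewrite size_rcons rcons_uniq ts_u andbT; split=> //.
      * by split=> // x xn; rewrite m3 ?m2 ?m1 //; lia.
      * move=> i; rewrite ltnS leq_eqVlt nth_rcons => /predU1P[->|i_ts].
          by rewrite ltnn eqxx.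
        rewrite i_ts -out // !m3 ?m2 //; lia.
      (* An equal triple in the list would come from the pair [(u, v)] itself, whose position has
         not been treated before. *)
      * apply/negP => /tsP[u0 [v0 [u0n v0n ltK em0 E]]].
        have [eu ev] := emits_inj un u0n (pred_neq u v un vn) em em0 E.
        by rewrite -eu -ev ltnn in ltK.
      * move=> x; rewrite mem_rcons inE; split=> [/predU1P[->|/tsP]|].
        - by exists u, v.
        - move=> [u0 [v0 [u0n v0n ltK em0 E]]]; exists u0, v0; split=> //.
          exact: ltnW.
        - move=> [u0 [v0 [u0n v0n ltK em0 ->]]]; apply/predU1P.
          case: (idx_ltS v0n vn ltK) => [{}ltK|[-> ->]]; last by left.
          by right; apply/tsP; exists u0, v0.
    move/eqP; rewrite eqb0 => ne; apply: wp_skip; exists ts; split=> //.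
    - by split=> //; rewrite m2.
    - by rewrite m2.
    - exact: leqW.
    - exact: skipP.
  look => e0; apply: wp_skip; exists ts; split=> //; first exact: leqW.
  by apply: skipP; rewrite /emits e0.
- move=> h1 [ts [[R8 m1] out ts_u ts_K tsP]] fr; fetch fr 0; fetch fr 1.
  apply: wp_seq; apply: (wp_asg W_gt1) => //; first by safety; lia.
  apply: (wp_asg W_gt1) => //; exists ts; split=> //.
  + apply: (@eq_from_nth _ (0, 0, 0)); rewrite size_mkseq; look => // i i_ts.
    by rewrite nth_mkseq //; look; rewrite -out.
  + by split=> //; rewrite /output_within; look; rewrite spaceE; lia.
  + move=> x; rewrite tsP; split=> -[u [v [un vn]]].
      by move=> _ em E; exists u, v.
    by move=> em E; exists u, v; split=> //; apply: idx_lt.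
Qed.

End Algorithm.

(** * Correctness *)

Lemma nth_allpairs (S T R : Type) (f : S -> T -> R) s t i j x0 y0 z0 :
  i < size s -> j < size t ->
  nth z0 [seq f x y | x <- s, y <- t] (i * size t + j) = f (nth x0 s i) (nth y0 t j).
Proof.
elim: s i => // x s IH [|i] /= i_s jt.
  by rewrite nth_cat size_map jt (nth_map y0).
by rewrite nth_cat size_map mulSn -addnA ltnNge leq_addr /= addKn IH.
Qed.

Lemma mem_input n (D : 'M[option nat]_n) (u v : 'I_n) :
  mem (input D) (u * n + v) = enc_entry (D u v).
Proof.
have -> : u * n + v = u * size (enum 'I_n) + v by rewrite size_enum_ord.
by rewrite /= (nth_allpairs _ u u) ?size_enum_ord // !nth_ord_enum.
Qed.

Lemma mem_input0 n (D : 'M[option nat]_n) x : n * n <= x -> mem (input D) x = 0.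
Proof. by move=> nx; rewrite /= nth_default // size_allpairs !size_enum_ord. Qed.

Section Correctness.

Variables (n : nat) (D : 'M[option nat]_n).
Hypothesis D_dist : distance_matrix D.

Let d u v := mem (input D) (u * n + v).

Variable inf : nat.
Hypothesis d_inf : forall u v, u < n -> v < n -> d u v <= inf.

Definition dist u v := if d u v == 0 then inf else (d u v).-1.

Variable e : nat -> nat -> nat.
Hypothesis eP : forall u v, u < n -> v < n -> pred_entry n dist inf (n * n) u v (e u v).

(** [None] decodes to [inf] and [Some k] to a number below it. This and the next two lemmas replace
    [D] by a table of numbers for all times below [inf]. *)
Lemma dist_Some (u v : 'I_n) t : (D u v == Some t) = (dist u v == t) && (t < inf).
Proof.
have := d_inf (ltn_ord u) (ltn_ord v); rewrite /dist /d mem_input.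
case: (D u v) => [k|] /= kinf; first by rewrite eqE /=; case: eqP => // <-.
by rewrite eqE /=; case: ltngtP => //; case: eqP => // <-; rewrite ltnn.
Qed.

Lemma dlt_dist (u v : 'I_n) t : t < inf -> dlt (D u v) t = (dist u v < t).
Proof.
rewrite /dist /d mem_input /dlt; case: (D u v) => //= tinf.
by apply/esym; rewrite ltnNge ltnW.
Qed.

Lemma dle_dist (u v : 'I_n) t : t < inf -> dle (D u v) t = (dist u v <= t).
Proof.
rewrite /dist /d mem_input /dle; case: (D u v) => //= tinf.
by apply/esym; rewrite leqNgt tinf.
Qed.

Lemma pred_le u v : u < n -> v < n -> e u v <= n.
Proof. by move=> un vn; case: (eP un vn) => [[->]|[x [xn _ ->]]]. Qed.

Lemma pred_neq u v : u < n -> v < n -> e u v != v.+1.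
Proof.
by move=> un vn; case: (eP un vn) => [[->]|[x [xn _ -> []]]].
Qed.

Lemma pred_good u v : u < n -> v < n -> e u v != 0 ->
  (e u v).-1 < n /\ good n dist inf u v (e u v).-1.
Proof.
by move=> un vn; case: (eP un vn) => [[->]//|[x [xn _ -> xg]]].
Qed.

Definition all_preds : Prop :=
  forall u v, u < n -> v < n -> u != v -> dist u v < inf -> e u v != 0.

(** The last edge of a foremost path from [u] to [v] starts at a good predecessor, both [no_jump]
    conditions being [Fo_tedge] in the two directions; an exhaustive search cannot have missed
    it. *)
Lemma realizable_all_preds : realizable D -> all_preds.
Proof.
case=> G GD u0 v0 un vn; pose u := Ordinal un; pose v := Ordinal vn.
rewrite -[u0]/(val u) -[v0]/(val v) => uv lt.
have uv' : u != v by [].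
have uvt : Fo G u v = Some (dist u v) by rewrite GD; apply/eqP; rewrite dist_Some eqxx.
have [x [ux xv]] := Fo_last_tedge uv' uvt.
case: (eP un vn) => [[_ /(_ x (ltn_ord x) (idx_lt vn (ltn_ord x)))] []|].
  split.
  - exact: tedge_neq xv.
  - by rewrite GD dlt_dist in ux.
  - exact: lt.
  - move=> y yn; have := @Fo_tedge _ _ (Ordinal yn) _ _ _ xv.
    by rewrite GD dlt_dist // dle_dist.
  - move=> y yn; rewrite tedgeC in xv; have := @Fo_tedge _ _ (Ordinal yn) _ _ _ xv.
    by rewrite GD dlt_dist // dle_dist.
by case=> y [_ _ ->].
Qed.

Section TripleList.

Variable ts : seq (nat * nat * nat).
Hypothesis triples_sub : forall x, x \in ts ->
  exists u v, [/\ u < n, v < n, e u v != 0 & x = triple dist e u v].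
Hypothesis triples_sup : forall u v, u < n -> v < n -> e u v != 0 ->
  triple dist e u v \in ts.

Lemma triples_ok a b t : (a, b, t) \in ts -> [/\ a < b, b < n & 0 < t].
Proof.
case/triples_sub=> u [v [un vn e0 [-> -> ->]]].
have [wn [wv lt _ _ _]] := pred_good un vn e0; split; [| |by lia].
  by move: wv; lia.
by rewrite gtn_max wn.
Qed.

(** The list stays abstract so that it can be the list of all chosen triples, for the decision, as
    well as the emitted list without repetitions, for the construction. *)
Lemma realization_triples : all_preds -> realization D (tgraph_of n ts).
Proof.
move=> cpl; apply: FoP => // [x u v t|u v t uv /eqP].
  rewrite tedge_tgraph_of; last exact: triples_ok.
  move=> uv.
  (* A triple forgets which endpoint was the predecessor, so the edge may be crossed in either
     sense; the two [no_jump] conditions of [good] cover both. *)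
  have [u0 [v0 [u0n v0n [tinf tE] nj]]] : exists u0 v0, [/\ u0 < n, v0 < n,
      t < inf /\ t = dist u0 v0 &
      forall y, y < n -> dist y u < dist u0 v0 -> dist y v <= dist u0 v0].
    by case/orP: uv => /triples_sub[u0 [v0 [u0n v0n e0 [E1 E2 E3]]]];
    have [wn [wv lt tinf nj1 nj2]] := pred_good u0n v0n e0;
    exists u0, v0; split; rewrite // ?E3 //;
    case: (leqP (e u0 v0).-1 v0) E1 E2 => _ -> ->.
  by rewrite dlt_dist // dle_dist // tE; apply: nj.
rewrite dist_Some => /andP[/eqP <- lt].
have e0 := cpl u v (ltn_ord u) (ltn_ord v) uv lt.
have [wn [wv ltw _ _ _]] := pred_good (ltn_ord u) (ltn_ord v) e0.
exists (Ordinal wn); split; first by rewrite dlt_dist.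
rewrite tedge_tgraph_of; last exact: triples_ok.
have := triples_sup (ltn_ord u) (ltn_ord v) e0; rewrite /triple /=.
by case: leqP => _ ->; rewrite ?orbT.
Qed.

End TripleList.

Lemma realizable_predsP : realizable D <-> all_preds.
Proof.
split=> [|cpl]; first exact: realizable_all_preds.
pose ts := [seq triple dist e z.1 z.2 |
  z <- [seq (u, v) | u <- iota 0 n, v <- iota 0 n] & e z.1 z.2 != 0].
exists (tgraph_of n ts); apply: realization_triples => //.
  move=> x /mapP[[u v]]; rewrite mem_filter /= => /andP[e0].
  case/allpairsP=> [[u' v'] /= []]; rewrite !mem_iota /= => un vn [uu' vv'] ->.
  by exists u, v; rewrite uu' vv' in e0 *.
move=> u v un vn e0; apply/mapP; exists (u, v) => //.
rewrite mem_filter e0; apply/allpairsP; exists (u, v).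
by rewrite !mem_iota.
Qed.

End Correctness.

(** * The two complete programs and their resource bounds *)

Lemma prepareP n w (D : 'M[option nat]_n) (HW : space n <= 2 ^ w) :
  wp w (space n) (2 * n) prepare (fun h => exists inf e,
    [/\ [/\ regs h 0 = n, regs h 1 = n * n & regs h 2 = inf],
      forall u v, u < n -> v < n -> mem (input D) (u * n + v) <= inf,
      forall u v, u < n -> v < n -> mem h (u * n + v) = dist D inf u v,
      forall u v, u < n -> v < n -> mem h (2 * (n * n) + (u * n + v)) = e u v &
      forall u v, u < n -> v < n -> pred_entry n (dist D inf) inf (n * n) u v (e u v)])
    (input D).
Proof.
have Wge := W_ge HW; have W1 := W_gt1 HW.
apply: wp_seq; apply: (wp_asg W1) => //; first by safety; lia.
set h0 := set_reg _ _ _.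
have [H0 H1] : regs h0 0 = n /\ regs h0 1 = n * n by [].
apply: wp_seq; apply: wp_call; first exact: max_entryP.
move=> h1 [m1 inf1] fr1; fetch fr1 0; fetch fr1 1.
apply: wp_seq; apply: wp_call; first exact: convertP.
move=> h2 [m2 m2'] fr2; fetch fr2 0; fetch fr2 1; fetch fr2 2.
apply: wp_seq; apply: wp_call; first exact: sort_columnsP.
move=> h3 [p3 m3 m3'] fr3; fetch fr3 0; fetch fr3 1; fetch fr3 2.
apply: wp_seq; apply: (wp_asg W1) => //; first by safety; lia.
set inf := regs h1 2 in reg3 reg6 inf1 m2.
pose p v r := mem h3 (n * n + (v * n + r)).
have m0 u v : u < n -> v < n -> mem h2 (u * n + v) = dist D inf u v.
  by move=> un vn; rewrite m2 // /dist m1.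
apply: wp_call.
  apply: (@find_predsP _ _ HW (dist D inf) p inf) => //.
  - have := @rank_sorts n (fun u v => mem h2 (u * n + v)) p p3.
    move=> sp v vn; have [pn psurj psort] := sp v vn; split=> // r r' rr' r'n.
    by have := psort r r' rr' r'n; rewrite !m0 // ?pn // (leq_ltn_trans rr').
  - by split=> // u v un vn; rewrite /= m3 ?m0 // idx_lt.
  - by look; lia.
  (* Everything from block 2 on still holds the zeros of the input, so each entry of block 2
     initially means no predecessor. *)
  - move=> y yn; rewrite [mem _ _]/= m3' // m2' ?m1; last by lia.
    by apply: mem_input0; lia.
move=> h4 [m4 e4] fr4; fetch fr4 0; fetch fr4 1; fetch fr4 2.
exists inf, (fun u v => mem h4 (2 * (n * n) + (u * n + v))); split=> //.
move=> u v un vn; have uv := idx_lt un vn.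
by rewrite m4 /= ?m3 ?m0 //; lia.
Qed.

Lemma input_represents n w (D : 'M[option nat]_n) :
  word_size_ok 8 w D -> represents w (input D) (input D).
Proof.
case=> HW HD; split=> //.
  have nW : n < 2 ^ w by apply: leq_trans HW; nia.
  by move=> x; rewrite /= /upd; case: eqP => // _; apply: leq_ltn_trans nW.
move=> x; have [lt|ge] := ltnP x (n * n); last first.
  by rewrite mem_input0 // expn_gt0.
have n0 : 0 < n by move: lt; case: (posnP n) => // ->.
have un : x %/ n < n by rewrite ltn_divLR.
have vn : x %% n < n by rewrite ltn_mod.
by rewrite (divn_eq x n) (mem_input D (Ordinal un) (Ordinal vn)).
Qed.

(** Depth 3 with 2n rounds per loop gives a multiple of (2n + 1)^3, at most 27 n^3; the logarithm
    enters only through being at least 1 from n = 2 on. *)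
Lemma big_O_cost c : depth c = 3 ->
  big_O (fun n => cost (2 * n) c) (fun n => n ^ 3 * log n).
Proof.
move=> c3; have [K HK] := cost_poly c; exists (K * 27), 2 => n n2.
apply: leq_trans (HK _) _; rewrite c3 -mulnA leq_mul2l; apply/orP; right.
have -> : 27 = 3 ^ 3 by [].
rewrite mulnA -expnMn; apply: leq_trans (leq_pmulr _ _); last by rewrite trunc_log_gt0.
by rewrite leq_exp2r //; lia.
Qed.

Lemma big_O_space : big_O space (fun n => n ^ 2).
Proof.
exists 32, 1 => n n1; rewrite /space -[32]/(8 * 2 ^ 2) -mulnA -expnMn leq_mul2l.
by rewrite leq_exp2r //; lia.
Qed.

Theorem theorem3p1 :
  (exists (p : cmd) (T S : nat -> nat),
    [/\ big_O T (fun n => n ^ 3 * log n),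
        big_O S (fun n => n ^ 2)
      & decides_foremost_TGR p T S]) /\
  (exists (p : cmd) (T S : nat -> nat),
    [/\ big_O T (fun n => n ^ 3 * log n),
        big_O S (fun n => n ^ 2)
      & constructs_foremost_TGR p T S]).
Proof.
split.
  exists (Seq prepare decide), (fun n => cost (2 * n) (Seq prepare decide)), space.
  split; [exact: big_O_cost | exact: big_O_space |].
  (* The word-size constant 8 is the one in [space], so all addresses in use are words. *)
  exists 8 => n D w D_dist Dw; have HW : space n <= 2 ^ w by case: Dw.
  have wp_pd : wp w (space n) (2 * n) (Seq prepare decide)
      (fun h => regs h 0 = `[< realizable D >]) (input D).
    apply: wp_seq; apply: wp_mono (@prepareP n w D HW).
    move=> h [inf [e [[H0 H1 H2] d_inf Ha He eP]]].
    apply: wp_mono (decideP HW Ha He H0 H1 H2) => h' [b -> bP].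
    congr nat_of_bool; apply/idP/asboolP => [/bP|] H.
      exact/(realizable_predsP D_dist d_inf eP).
    exact/bP/(realizable_predsP D_dist d_inf eP).
  have [t [st [h [ex ct [_ r _ _] Q]]]] := wp_pd _ (input_represents Dw).
  by exists t, st; split=> //; rewrite r.
exists (Seq prepare emit), (fun n => cost (2 * n) (Seq prepare emit)), space.
split; [exact: big_O_cost | exact: big_O_space |].
exists 8 => n D w D_dist Dw Dr; have HW : space n <= 2 ^ w by case: Dw.
have wp_pe : wp w (space n) (2 * n) (Seq prepare emit)
    (fun h => exists G : tgraph n, [/\ output_within (space n) h,
       lists_tgraph (output_triples h) G, realization D G & nlabels G <= n ^ 2])
    (input D).
  apply: wp_seq; apply: wp_mono (@prepareP n w D HW).
  move=> h [inf [e [[H0 H1 H2] d_inf Ha He eP]]].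
  apply: wp_mono (emitP HW Ha He (pred_le eP) (pred_neq eP) H0 H1).
  move=> h' [ts [-> ts_u [ts_n out] tsP]].
  have triples_sub x : x \in ts -> exists u v,
      [/\ u < n, v < n, e u v != 0 & x = triple (dist D inf) e u v].
    by case/tsP=> u [v [un vn /andP[e0 _] E]]; exists u, v.
  have triples_sup u v : u < n -> v < n -> e u v != 0 -> triple (dist D inf) e u v \in ts.
    move=> un vn e0; apply/tsP.
    have [u' [v' [? ? ? E]]] := emits_cover (dist D inf) (pred_le eP) un vn e0.
    by exists u', v'.
  exists (tgraph_of n ts); split=> //.
  - exact/lists_tgraph_of/(triples_ok eP triples_sub).
  - apply: (realization_triples D_dist d_inf eP triples_sub triples_sup).
    exact/(realizable_predsP D_dist d_inf eP).
  - exact: leq_trans (nlabels_tgraph_of _ _) ts_n.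
have [t [st [h [ex ct [m r _ _] [G [out L GD nl]]]]]] := wp_pe _ (input_represents Dw).
exists t, st, G; split=> //; move: out L.
by rewrite /output_within /output_triples m !r.
Qed.
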